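(* Let $G$ be a locally reasonable metric group. Let $\mathcal K$ be a compact subset of $G$, let $0<\varepsilon<R$, $K\ge1$, and let $A,B\subseteq\mathcal K$ be non-empty. Then the following two statements are equivalent, in the sense that if one of them holds for one choice of implied constants in the $O()$ and $\lesssim$ notation, then the other holds for some (possibly different) choice of implied constants: (i) $\mathcal N_\varepsilon(A\cdot B)\lesssim_{\mathcal K,R,G}K^{O(1)}\mathcal N_\varepsilon(A)^{1/2}\mathcal N_\varepsilon(B)^{1/2}$. (ii) There exist an $O_{\mathcal K,R,G}(K^{O(1)})$-approximate group $H$ with $\mathcal N_\varepsilon(H)\lesssim_{\mathcal K,R,G}K^{O(1)}\mathcal N_\varepsilon(A)^{1/2}\mathcal N_\varepsilon(B)^{1/2}$ and a finite set $X$ of cardinality $O_{\mathcal K,R,G}(K^{O(1)})$ such that $A\subseteq X\cdot H$ and $B\subseteq H\cdot X$; furthermore $H$ and $X$ lie in a compact set $\tilde{\mathcal K}=\tilde{\mathcal K}(\mathcal K,R)$ depending only on $\mathcal K$ and $R$.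
   Context: A multiplicative group is a topological group $G$ with a non-negative Radon measure $\mu$ invariant under left and right translation and inversion, with every non-empty open set of positive measure; a multiplicative set is a non-empty open precompact subset. A multiplicative set $H$ is an $L$-approximate group if $H^{-1}=H$ and there is a finite symmetric $X\subseteq H\cdot H$ with $|X|\le L$ and $H\cdot H\subseteq X\cdot H$. A multiplicative group with metric $d_G$ is a locally reasonable metric group if: (a) the metric balls generate the topology and all closed balls are compact; (b) for every compact $\mathcal K\subseteq G$ there is $C$ with $C^{-1}d_G(x,y)\le d_G(gx,gy),d_G(xg,yg),d_G(x^{-1},y^{-1})\le Cd_G(x,y)$ for all $x,y,g\in\mathcal K$; (c) for every $R>0$ there is $C_R$ with $\mu(\mathbf B(1,2r))\le C_R\,\mu(\mathbf B(1,r))$ for $0<r<R$, where $\mathbf B(x,r)$ is the open ball of radius $r$ about $x$. $\mathcal N_\varepsilon(X)$ is the least number of open balls of radius $\varepsilon$ covering $X$. Notation: $X\lesssim_{\mathcal K,R,G}K^{O(1)}Y$ means $X\le CK^CY$ with $C$ depending only on $\mathcal K,R,G$; $O_{\mathcal K,R,G}(K^{O(1)})$ is a quantity at most such $CK^C$. *)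

(* Defs.v *)
From HB Require Import structures.
From mathcomp Require Import all_boot all_order all_algebra finmap.
From mathcomp Require Import all_classical all_reals all_analysis.

Set Implicit Arguments.
Unset Strict Implicit.
Unset Printing Implicit Defensive.

Import Order.TTheory GRing.Theory Num.Theory.

Local Open Scope classical_set_scope.
Local Open Scope ring_scope.

(* The topology of a [metricType] is by construction the one generated by its
   open balls [ball x r = [set y | mdist x y < r]]. The
   distinguished point required of [measurableType]s is unrelated to the group
   structure and plays no role. *)
#[short(type="metricGroupType")]
HB.structure Definition MetricGroup (R : numDomainType) :=
  {G of Group G & Metric R G & Pointed G}.

Definition mulsetg (G : groupType) (A B : set G) : set G :=
  [set (x * y)%g | x in A & y in B].

Definition invsetg (G : groupType) (A : set G) : set G :=
  [set (x^-1)%g | x in A].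

Definition borel (T : ptopologicalType) := g_sigma_algebraType (@open T).

Record radon (R : realType) (T : ptopologicalType)
    (mu : {measure set (borel T) -> \bar R}) : Prop := {
  radon_compact : forall A : set T, compact A -> (mu A < +oo)%E ;
  radon_outer : forall A : set (borel T), measurable A ->
    mu A = ereal_inf [set mu U | U in [set U : set T | open U /\ A `<=` U]] ;
  radon_inner : forall U : set T, open U ->
    mu U = ereal_sup [set mu A | A in [set A : set T | compact A /\ A `<=` U]]
}.

Record multiplicative_group (R : realType) (G : metricGroupType R)
    (mu : {measure set (borel G) -> \bar R}) : Prop := {
  mulg_continuous : continuous (fun xy : G * G => (xy.1 * xy.2)%g) ;
  invg_continuous : continuous (fun x : G => x^-1%g) ;
  haar_radon : radon mu ;
  haar_mull : forall (g : G) (A : set (borel G)), measurable A ->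
    mu (mulsetg [set g] A) = mu A ;
  haar_mulr : forall (g : G) (A : set (borel G)), measurable A ->
    mu (mulsetg A [set g]) = mu A ;
  haar_inv : forall A : set (borel G), measurable A ->
    mu (invsetg A) = mu A ;
  haar_gt0 : forall U : set G, open U -> U !=set0 -> (0 < mu U)%E
}.

Record locally_reasonable (R : realType) (G : metricGroupType R)
    (mu : {measure set (borel G) -> \bar R}) : Prop := {
  lr_multiplicative : multiplicative_group mu ;
  lr_closed_ball : forall (x : G) (r : R),
    compact [set y : G | mdist x y <= r] ;
  lr_lipschitz : forall cK : set G, compact cK ->
    exists2 C : R, 0 < C & forall x y g, cK x -> cK y -> cK g ->
      [/\ C^-1 * mdist x y <= mdist (g * x)%g (g * y)%g <= C * mdist x y,
          C^-1 * mdist x y <= mdist (x * g)%g (y * g)%g <= C * mdist x y &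
          C^-1 * mdist x y <= mdist x^-1%g y^-1%g <= C * mdist x y] ;
  lr_doubling : forall R0 : R, 0 < R0 ->
    exists C : R, forall r : R, 0 < r -> r < R0 ->
      (mu (ball (1%g : G) (2 * r)) <= C%:E * mu (ball (1%g : G) r))%E
}.

Definition multiplicative_set (R : realType) (G : metricGroupType R)
    (H : set G) : Prop :=
  [/\ H !=set0, open H & precompact H].

Definition approximate_group (R : realType) (G : metricGroupType R)
    (L : R) (H : set G) : Prop :=
  [/\ multiplicative_set H,
      invsetg H = H &
      exists X : {fset G},
        [/\ invsetg [set` X] = [set` X],
            [set` X] `<=` mulsetg H H,
            (#|` X|)%:R <= L &
            mulsetg H H `<=` mulsetg [set` X] H]].

(* The centres of the balls range over all of [G]; the value is [+oo] when no
   finite cover exists, which does not happen for precompact [X]. *)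
Definition covering_number (R : realType) (G : metricType R)
    (eps : R) (X : set G) : \bar R :=
  ereal_inf [set ((#|` F|)%:R)%:E | F in
    [set F : {fset G} | X `<=` \bigcup_(x in [set` F]) ball x eps]].

(* A quantity that is O(K^{O(1)}) with implied constant C. *)
Definition poly_bound (R : realType) (C K : R) : R := C * K `^ C.

Definition entropy_bound (R : realType) (G : metricType R)
    (C eps K : R) (A B : set G) : \bar R :=
  ((poly_bound C K)%:E *
     (covering_number eps A `^ 2^-1 * covering_number eps B `^ 2^-1))%E.

Definition small_product (R : realType) (G : metricGroupType R)
    (C eps K : R) (A B : set G) : Prop :=
  (covering_number eps (mulsetg A B) <= entropy_bound C eps K A B)%E.

(* C1, C2, C3 are the implied constants for the approximate group, for its
   metric entropy and for the cardinality of X. *)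
Definition controlled_by_approximate_group (R : realType)
    (G : metricGroupType R) (Kt : set G) (C1 C2 C3 eps K : R)
    (A B : set G) : Prop :=
  exists (H : set G) (X : {fset G}),
    [/\ approximate_group (poly_bound C1 K) H,
        (covering_number eps H <= entropy_bound C2 eps K A B)%E,
        (#|` X|)%:R <= poly_bound C3 K,
        A `<=` mulsetg [set` X] H /\ B `<=` mulsetg H [set` X] &
        H `<=` Kt /\ [set` X] `<=` Kt].

(* Main.v *)
Require Import Defs.
From HB Require Import structures.
From mathcomp Require Import all_boot all_order all_algebra finmap.
From mathcomp Require Import all_classical all_reals all_analysis.
From mathcomp Require Import zify ring lra.

Set Implicit Arguments.
Unset Strict Implicit.
Unset Printing Implicit Defensive.

Import Order.TTheory GRing.Theory Num.Theory.

Local Open Scope classical_set_scope.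
Local Open Scope ring_scope.

(** Everything is counted at a scale [delta] comparable to [eps], where doubling
    of the Haar measure makes covering numbers and sizes of maximal separated
    sets interchangeable up to constants, and translations and inversion are
    bi-Lipschitz, so that the counting arguments for finite subsets of groups
    survive up to constants. Ruzsa's triangle inequality turns a small [A B]
    into a small [A A^-1]. The set [S] of quotients in [A^-1 A] with many
    representations is large by Cauchy-Schwarz, symmetric, and [A S Y] is not
    much larger than [A Y], so every product [A S ... S] is small. With [U] a
    symmetric neighbourhood of [1] of size about [delta], [H = S U S] is then
    the approximate group, and the finite sets come from Ruzsa's covering
    lemma applied with translates of [S]. *)

(** In a noncommutative group a small [A A^-1] does not control longer products such as [A A^-1 A],
    so the triangle inequality alone cannot yield an approximate group. Popularity supplies the
    missing bound: a product with a popular quotient inserted after [A] factors through [A A^-1] and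
    [A Y] in so many ways that each further insertion costs only a bounded power of the doubling
    constant. All products are therefore estimated behind a leading [A], which one translation
    removes at the end. The metric is not invariant, so exact identities become closeness. Each
    translation or inversion multiplies distances by a constant that is valid only on a bounded set.
    Two devices keep this in check: words have bounded length, so one Lipschitz constant suffices,
    and after each counting argument the radius is brought back to [delta] at the price of one
    factor [D]. Sizes are counted in natural numbers; square roots and real powers of [K] enter only
    in the final translation. *)

Definition indep (T : eqType) (e : T -> T -> Prop) (Z : seq T) : Prop :=
  uniq Z /\ {in Z &, forall x y, e x y -> x = y}.

(** Greedy selection: a point of [Y] related to no member of [s] can be added, and [b] stops the
    process. The relation is general because it will express both closeness of points and near
    overlap of translates. *)
Lemma maximal_indep (T : eqType) (e : T -> T -> Prop) (Y : set T) (b : nat) :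
  (forall x, Y x -> e x x) -> (forall x y, e x y -> e y x) ->
  (forall s, indep e s -> {in s, forall x, Y x} -> (size s <= b)%N) ->
  exists s, [/\ indep e s, {in s, forall x, Y x} &
    forall y, Y y -> exists2 x, x \in s & e x y].
Proof.
move=> er es bnd.
(* [k] bounds the number of points that can still be added. *)
suff ext k s : (b - size s <= k)%N -> indep e s -> {in s, forall x, Y x} ->
    exists s, [/\ indep e s, {in s, forall x, Y x} &
      forall y, Y y -> exists2 x, x \in s & e x y].
  by apply: (ext b [::]) => //; rewrite ?subn0.
elim: k s => [|k IH] s bs is_ sY;
  have [[y Yy ny]|ny] := pselect (exists2 y, Y y & forall x, x \in s -> ~ e x y).
- have : (size (y :: s) <= b)%N.
    apply: bnd; last by move=> x; rewrite inE => /orP[/eqP->|/sY].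
    case: is_ => us i; split=> /=.
      by rewrite us andbT; apply/negP => ys; apply: (ny y ys); apply: er.
    move=> x z; rewrite !inE => /orP[/eqP->|xs] /orP[/eqP->|zs] // exz.
    - by case: (ny z zs); apply: es.
    - by case: (ny x xs).
    - exact: i.
  by move=> /=; lia.
- exists s; split => // y Yy; apply: contrapT => h; apply: ny; exists y => // x xs exy.
  by apply: h; exists x.
- apply: (IH (y :: s)); first by move=> /=; lia.
    case: is_ => us i; split=> /=.
      by rewrite us andbT; apply/negP => ys; apply: (ny y ys); apply: er.
    move=> x z; rewrite !inE => /orP[/eqP->|xs] /orP[/eqP->|zs] // exz.
    - by case: (ny z zs); apply: es.
    - by case: (ny x xs).
    - exact: i.
  by move=> x; rewrite inE => /orP[/eqP->|/sY].
- exists s; split => // y Yy; apply: contrapT => h; apply: ny; exists y => // x xs exy.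
  by apply: h; exists x.
Qed.

(** * Covers, separated sets and pigeonhole counting in a metric space *)

Section Covering.
Variables (R : realType) (T : metricType R).
Implicit Types (r : R) (Y : set T) (F Z : seq T).

Definition covered r Y (m : nat) : Prop :=
  exists2 F : seq T, (size F <= m)%N &
    forall y, Y y -> exists2 c, c \in F & mdist c y < r.

Definition separated r Z : Prop := indep (fun x y => mdist x y < r) Z.

(** The index of the first ball of the cover that contains [y], and [size F] if there is none. It
    turns a cover into a colouring. *)
Definition cell F r (y : T) : nat := find (fun c => mdist c y < r) F.

Lemma cell_size F r y : (exists2 c, c \in F & mdist c y < r) ->
  (cell F r y < size F)%N.
Proof. by move=> [c cF cy]; rewrite -has_find; apply/hasP; exists c. Qed.

Lemma cell_close F r y z : (exists2 c, c \in F & mdist c y < r) ->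
  (exists2 c, c \in F & mdist c z < r) -> cell F r y = cell F r z ->
  mdist y z < 2 * r.
Proof.
move=> hy hz yz.
have y1 : mdist (nth y F (cell F r y)) y < r.
  by apply: (@nth_find _ y (fun c => mdist c y < r)); rewrite has_find; exact: cell_size.
have z1 : mdist (nth y F (cell F r z)) z < r.
  by apply: (@nth_find _ y (fun c => mdist c z < r)); rewrite has_find; exact: cell_size.
rewrite -yz in z1.
have := metric_triangle y (nth y F (cell F r y)) z.
rewrite (metric_sym y (nth _ _ _)); lra.
Qed.

Lemma covered_leq r Y m n : (m <= n)%N -> covered r Y m -> covered r Y n.
Proof. by move=> mn [F Fm h]; exists F => //; exact: leq_trans mn. Qed.

Lemma covered_sub r Y1 Y2 m : Y1 `<=` Y2 -> covered r Y2 m -> covered r Y1 m.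
Proof. by move=> s [F Fm h]; exists F => // y /s/h. Qed.

Lemma covered_le r r' Y m : r <= r' -> covered r Y m -> covered r' Y m.
Proof.
move=> rr [F Fm h]; exists F => // y /h[c cF cy]; exists c => //.
exact: lt_le_trans rr.
Qed.

Lemma coveredU r Y1 Y2 m1 m2 :
  covered r Y1 m1 -> covered r Y2 m2 -> covered r (Y1 `|` Y2) (m1 + m2).
Proof.
move=> [F1 s1 h1] [F2 s2 h2]; exists (F1 ++ F2).
  by rewrite size_cat leq_add.
by move=> y [/h1|/h2] [c cF cy]; exists c => //; rewrite mem_cat cF ?orbT.
Qed.

Lemma covered_seq (I : eqType) (s : seq I) (Y : I -> set T) r m :
  {in s, forall i, covered r (Y i) m} ->
  covered r [set y | exists2 i, i \in s & Y i y] (size s * m).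
Proof.
elim: s => [_|i s IH h]; first by exists [::] => // y [].
rewrite mulSn; apply: (@covered_sub _ _
    (Y i `|` [set y | exists2 i, i \in s & Y i y])).
  move=> y [j]; rewrite inE => /orP[/eqP->|js] Yj; first by left.
  by right; exists j.
apply: coveredU; first by apply: h; rewrite mem_head.
by apply: IH => j js; apply: h; rewrite inE js orbT.
Qed.

(* [X] plays the role of the image of [Y] under a multivalued map [rel] whose
   inverse is coarsely Lipschitz. *)
Lemma covered_rel r r' (X : set T) Y m
    (rel : T -> T -> Prop) :
  covered r X m -> (forall y, Y y -> exists2 x, X x & rel y x) ->
  (forall y y' x x', Y y -> Y y' -> X x -> X x' -> rel y x -> rel y' x' ->
    mdist x x' < 2 * r -> mdist y y' < r') ->
  covered r' Y m.
Proof.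
move=> [F Fm FX] h1 h2.
have [[y0 Yy0]|nY] := pselect (exists y, Y y); last first.
  by exists [::] => // y Yy; case: nY; exists y.
(* Each ball of the cover of [X] is replaced by a ball around a point of [Y] that has a related
   point in the former. *)
pose P c y := Y y /\ exists2 x, X x & rel y x /\ mdist c x < r.
pose pt c := xget y0 [set y | P c y].
exists [seq pt c | c <- F]; first by rewrite size_map.
move=> y Yy; have [x Xx yx] := h1 y Yy; have [c cF cx] := FX x Xx.
exists (pt c); first by apply/mapP; exists c.
have [Yp [x' Xx' [px cx']]] : P c (pt c).
  by apply: (@xgetPex _ y0 [set y | P c y]); exists y; split=> //; exists x.
apply: (h2 _ _ x' x) => //.
have := metric_triangle x' c x.
rewrite (metric_sym x' c); lra.
Qed.

Lemma size_separated r Y m Z : covered r Y m -> separated (2 * r) Z ->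
  {in Z, forall z, Y z} -> (size Z <= m)%N.
Proof.
move=> [F Fm FY] [uZ sZ] ZY; apply: leq_trans Fm.
rewrite -(size_map (cell F r)) -(size_iota 0 (size F)).
apply: uniq_leq_size.
  rewrite map_inj_in_uniq // => x y xZ yZ xy; apply: sZ => //.
  by apply: cell_close xy; apply/FY/ZY.
move=> i /mapP[z zZ ->]; rewrite mem_iota /= add0n.
by apply/cell_size/FY/ZY.
Qed.

Lemma maximal_separated r Y b : 0 < r ->
  (forall s, separated r s -> {in s, forall x, Y x} -> (size s <= b)%N) ->
  exists s, [/\ separated r s, {in s, forall x, Y x} & covered r Y (size s)].
Proof.
move=> r0 bnd; have [| |s [s1 s2 s3]] := maximal_indep _ _ bnd.
- by move=> x _; rewrite mdistxx.
- by move=> x y; rewrite metric_sym.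
- by exists s; split=> //; exists s.
Qed.

(** The double counting behind every cardinality estimate: [(w, j)] is determined by the cells of
    [f w j] and [g w j], since points of one cell are less than [2 * r] apart. The factor [e]
    expresses a lower bound [n / e] on the number of representations without division. *)
Lemma count_pairs (J : eqType) r (P Q : set T) p q (W : seq T) (I : T -> seq J)
    (f g : T -> J -> T) (n e : nat) :
  covered r P p -> covered r Q q -> uniq W ->
  {in W, forall w, uniq (I w) /\ (n <= e * size (I w))%N} ->
  {in W, forall w j, j \in I w -> P (f w j) /\ Q (g w j)} ->
  (forall w w' j j', w \in W -> w' \in W -> j \in I w -> j' \in I w' ->
    mdist (f w j) (f w' j') < 2 * r -> mdist (g w j) (g w' j') < 2 * r ->
    w = w' /\ j = j') ->
  (size W * n <= e * (p * q))%N.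
Proof.
move=> [F Fp FP] [H Hq HQ] uW hI hfg inj.
pose L := [seq (w, j) | w <- W, j <- I w].
have LP wj : wj \in L -> wj.1 \in W /\ wj.2 \in I wj.1.
  by move=> /allpairsPdep[w [j [wW jI ->]]].
have uL : uniq L.
  apply: allpairs_uniq_dep => //; first by move=> w /hI[].
  by move=> [w j] [w' j'] _ _ /= [-> ->].
have sL : (size L <= p * q)%N.
  pose c (wj : T * J) := (cell F r (f wj.1 wj.2), cell H r (g wj.1 wj.2)).
  rewrite -(size_map c); apply: (@leq_trans (size F * size H)); last exact: leq_mul.
  rewrite -[leqRHS](_ : size [seq (i, j) | i <- iota 0 (size F), j <- iota 0 (size H)] = _).
    apply: uniq_leq_size.
      rewrite map_inj_in_uniq // => -[w j] [w' j'] /LP[/= w1 j1] /LP[/= w2 j2].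
      case=> cf cg; have [f1 g1] := hfg w w1 j j1; have [f2 g2] := hfg w' w2 j' j2.
      have [||-> ->//] := inj w w' j j' w1 w2 j1 j2.
      - by apply: cell_close cf; apply/FP.
      - by apply: cell_close cg; apply/HQ.
    move=> _ /mapP[[w j] /LP[/= w1 j1] ->].
    have [f1 g1] := hfg w w1 j j1.
    apply/allpairsP; exists (c (w, j)); rewrite !mem_iota /= !add0n.
    by split=> //; [apply/cell_size/FP|apply/cell_size/HQ].
  by rewrite size_allpairs !size_iota.
apply: (@leq_trans (e * size L)); last by rewrite leq_mul2l sL orbT.
rewrite /L size_allpairs_dep.
have {uL sL LP L inj hfg uW} : {in W, forall w, (n <= e * size (I w))%N}.
  by move=> w /hI[].
clear; elim: W => [|w W IH] h; first by [].
rewrite /= mulSn mulnDr leq_add //; first by apply: h; rewrite mem_head.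
by apply: IH => x xW; apply: h; rewrite inE xW orbT.
Qed.

End Covering.


(** * Cauchy-Schwarz and popular pairs for an abstract colouring *)

Section Energy.
Local Open Scope set_scope.
Local Open Scope nat_scope.
Variables (n p : nat) (cl : 'I_n -> 'I_n -> 'I_p).

(** [cl a b] models the cell of [a b^-1]. A pair [(d, b)] here is thus an approximate solution of
    [a b^-1 = c d^-1], that is, a representation [d^-1 b] of the quotient [c^-1 a]. *)
Definition reps (c a : 'I_n) : {set 'I_n * 'I_n} :=
  [set db | cl a db.2 == cl c db.1].

(** The threshold [n ^ 2 / (2 p)] is half the average number of representations guaranteed by
    Cauchy-Schwarz. *)
Definition popular : {set 'I_n * 'I_n} :=
  [set ca | (n ^ 2 <= 2 * p * #|reps ca.1 ca.2|)%N].

Lemma card_repsC c a : #|reps a c| = #|reps c a|.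
Proof.
rewrite -(card_imset (reps c a) (f := fun db => (db.2, db.1))); last first.
  by move=> [a1 b1] [a2 b2] /= [-> ->].
apply: eq_card => -[d b]; rewrite !inE /= eq_sym.
apply/idP/imsetP => [h|[[d' b']]]; last by rewrite inE /= => h [-> ->].
by exists (b, d); rewrite ?inE.
Qed.

Lemma popularC c a : ((c, a) \in popular) = ((a, c) \in popular).
Proof. by rewrite !inE /= card_repsC. Qed.

Lemma nat_cauchy (r : 'I_p -> nat) :
  ((\sum_i r i) ^ 2 <= p * \sum_i r i ^ 2)%N.
Proof.
rewrite -(leq_pmul2l (ltn0Sn 1)).
have -> : (2 * (\sum_i r i) ^ 2 = \sum_i \sum_j 2 * (r i * r j))%N.
  rewrite -mulnn big_distrl big_distrr /=; apply: eq_bigr => i _.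
  by rewrite !big_distrr /=.
have -> : (2 * (p * \sum_i r i ^ 2) = \sum_i \sum_j (r i ^ 2 + r j ^ 2))%N.
  under [in RHS]eq_bigr do rewrite big_split /= sum_nat_const card_ord.
  rewrite big_split /= sum_nat_const card_ord -big_distrr /=; lia.
by apply: leq_sum => i _; apply: leq_sum => j _; exact: nat_Cauchy.
Qed.

(** The energy is at least [n ^ 4 / p]. Unpopular pairs contribute at most half of that, and a
    popular pair contributes at most [n]. *)
Lemma popular_large (inj : forall c, injective (cl c)) :
  (n ^ 3 <= 2 * p * #|popular|)%N.
Proof.
case: (posnP n) => [n0|n0]; first by rewrite [X in (X ^ _)%N]n0 exp0n.
pose r (i : 'I_p) := #|[set ab : 'I_n * 'I_n | cl ab.1 ab.2 == i]|.
have rE i : r i = \sum_ab (cl ab.1 ab.2 == i).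
  by rewrite /r cardsE -sum1_card big_mkcond /=.
have sr : \sum_i r i = (n ^ 2)%N.
  under eq_bigr do rewrite rE.
  rewrite exchange_big /= (eq_bigr (fun=> 1%N)); last first.
    move=> ab _; rewrite (bigD1 (cl ab.1 ab.2)) //= eqxx big1 // => i.
    by rewrite eq_sym => /negbTE ->.
  by rewrite sum_nat_const card_prod card_ord muln1.
have repE c a : #|reps c a| = \sum_b \sum_d (cl a b == cl c d).
  rewrite /reps cardsE -sum1_card big_mkcond /= exchange_big pair_big /=.
  by apply: eq_bigr => -[d b].
(* Both sides count the quadruples with [cl a b = cl c d]. *)
have en : \sum_i r i ^ 2 = \sum_ca #|reps ca.1 ca.2|.
  transitivity (\sum_ab r (cl ab.1 ab.2)).
    under eq_bigr do rewrite -mulnn {1}rE big_distrl /=.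
    rewrite exchange_big /=; apply: eq_bigr => ab _.
    rewrite (bigD1 (cl ab.1 ab.2)) //= eqxx mul1n big1 ?addn0 // => i.
    by rewrite eq_sym => /negbTE ->; rewrite mul0n.
  rewrite -(pair_big xpredT xpredT (fun a b => r (cl a b))) /=.
  rewrite -(pair_big xpredT xpredT (fun c a => #|reps c a|)) /=.
  rewrite [RHS]exchange_big /=; apply: eq_bigr => a _.
  under [RHS]eq_bigr do rewrite repE.
  rewrite [RHS]exchange_big /=; apply: eq_bigr => b _.
  rewrite rE -(pair_big xpredT xpredT (fun c d => (cl c d == cl a b : nat))) /=.
  by apply: eq_bigr => c _; apply: eq_bigr => d _; rewrite eq_sym.
(* Injectivity of [cl c] leaves at most one [d] for each [b]. *)
have rn c a : (#|reps c a| <= n)%N.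
  rewrite repE; apply: (@leq_trans (\sum_(b < n) 1)); last first.
    by rewrite sum_nat_const card_ord muln1.
  apply: leq_sum => b _.
  have [[d0 hd]|hd] := pselect (exists d, cl a b == cl c d); last first.
    rewrite big1 // => d _; case: eqP => // h; case: hd; exists d; exact/eqP.
  rewrite (bigD1 d0) //= hd big1 // => d dd0; case: eqP => // h.
  by move: dd0; rewrite -(inj_eq (@inj c)) -h (eqP hd) eqxx.
have cs : (n ^ 4 <= p * \sum_ca #|reps ca.1 ca.2|)%N.
  by rewrite -en; apply: leq_trans (nat_cauchy r); rewrite sr -expnM.
have spl : (2 * p * \sum_ca #|reps ca.1 ca.2| <=
    2 * p * (#|popular| * n) + n ^ 4)%N.
  rewrite (bigID (mem popular)) /= mulnDr leq_add //.
    rewrite leq_mul2l; apply/orP; right.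
    by rewrite -sum_nat_const; apply: leq_sum => ca _.
  rewrite big_distrr /=; apply: (@leq_trans (\sum_(ca : 'I_n * 'I_n) n ^ 2)).
    rewrite [leqRHS](bigID (mem popular)) /=; apply: leq_trans (leq_addl _ _).
    by apply: leq_sum => ca; rewrite inE -ltnNge => /ltnW.
  by rewrite sum_nat_const card_prod card_ord mulnn -expnD.
rewrite -(leq_pmul2r n0) -expnSr.
by move: cs spl; rewrite -!mulnA; lia.
Qed.

End Energy.

(* [lev k] stands for the set of [k]-fold products from a fixed symmetric
   bounded set; levels up to 30 suffice for every product formed below. *)
Record scale (R : realType) (G : metricGroupType R) (lev : nat -> set G)
    (C delta : R) (D : nat) : Prop := Scale {
  lev_1 : lev 0%N 1%g ;
  lev_mul : forall k l x y, lev k x -> lev l y -> lev (k + l)%N (x * y)%g ;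
  lev_inv : forall k x, lev k x -> lev k x^-1%g ;
  lev_le : forall k l, (k <= l)%N -> lev k `<=` lev l ;
  scale_C : 1 <= C ;
  scale_delta : 0 < delta ;
  scale_lip : forall g x y, lev 30%N g -> lev 30%N x -> lev 30%N y ->
    [/\ mdist (g * x)%g (g * y)%g <= C * mdist x y,
        mdist (x * g)%g (y * g)%g <= C * mdist x y &
        mdist x^-1%g y^-1%g <= C * mdist x y] ;
  scale_small : forall u : G, mdist 1%g u < 2 * C * delta -> lev 1%N u ;
  scale_doubling : forall Y m, Y `<=` lev 30%N ->
    covered (16 * C ^+ 6 * delta) Y m -> covered delta Y (D * m)
}.

Lemma lev_leP (R : realType) (G : metricGroupType R) (lev : nat -> set G)
    (C delta : R) (D : nat) (hS : scale lev C delta D) k l x :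
  lev k x -> (k <= l)%N -> lev l x.
Proof. by move=> kx kl; exact: (lev_le hS kl). Qed.

(** The Lipschitz estimates ask for membership in [lev 30]. [levs] computes a level of a word from
    the levels of its letters, and [lv] weakens it to the level required. *)
Ltac levs hS := first
  [ eassumption
  | eapply (lev_mul hS); levs hS
  | eapply (lev_inv hS); levs hS
  | exact: (lev_1 hS) ].
Ltac lv := match goal with hS : scale _ _ _ _ |- _ =>
  by (eapply (lev_leP hS); [levs hS | done]) end.

(** * Coarse estimates at one scale *)

Section Scale.
Variables (R : realType) (G : metricGroupType R) (lev : nat -> set G).
Variables (C delta : R) (D : nat) (hS : scale lev C delta D).
Implicit Types (A B Y Z : set G) (x y z g : G).

Local Notation d := (@mdist R G).

(** The radius that [delta] grows to after [i] translations or inversions. *)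
Definition rad (i : nat) : R := C ^+ i * delta.

Lemma rad0 : rad 0 = delta. Proof. by rewrite /rad expr0 mul1r. Qed.

Lemma rad_gt0 i : 0 < rad i.
Proof.
apply: mulr_gt0 (scale_delta hS); rewrite exprn_gt0 //.
exact: lt_le_trans (scale_C hS).
Qed.

Lemma rad_le i j : (i <= j)%N -> rad i <= rad j.
Proof.
move=> ij; rewrite ler_pM2r ?(scale_delta hS) //.
exact: (ler_weXn2l (scale_C hS)).
Qed.

Lemma C_lt (s t a : R) i : s < t -> t <= a * rad i -> C * s < a * rad i.+1.
Proof.
move=> st ta; have C0 : 0 < C by exact: lt_le_trans (scale_C hS).
have -> : a * rad i.+1 = C * (a * rad i) by rewrite /rad exprS; ring.
by rewrite ltr_pM2l //; exact: lt_le_trans ta.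
Qed.

(** Keeping [t] apart from [a * rad i] lets any earlier estimate be fed in; the comparison of radii
    is left to linear arithmetic. *)
Lemma lipl g x y t a i : lev 30%N g -> lev 30%N x -> lev 30%N y ->
  d x y < t -> t <= a * rad i -> d (g * x)%g (g * y)%g < a * rad i.+1.
Proof.
move=> hg hx hy xy ta; have [h _ _] := scale_lip hS hg hx hy.
by apply: le_lt_trans h _; apply: C_lt ta.
Qed.

Lemma lipr g x y t a i : lev 30%N g -> lev 30%N x -> lev 30%N y ->
  d x y < t -> t <= a * rad i -> d (x * g)%g (y * g)%g < a * rad i.+1.
Proof.
move=> hg hx hy xy ta; have [_ h _] := scale_lip hS hg hx hy.
by apply: le_lt_trans h _; apply: C_lt ta.
Qed.

Lemma lipi x y t a i : lev 30%N x -> lev 30%N y ->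
  d x y < t -> t <= a * rad i -> d x^-1%g y^-1%g < a * rad i.+1.
Proof.
move=> hx hy xy ta; have [_ _ h] := scale_lip hS hx hx hy.
by apply: le_lt_trans h _; apply: C_lt ta.
Qed.

Lemma cancell g x y t a i : lev 30%N g -> lev 30%N (g * x)%g ->
  lev 30%N (g * y)%g ->
  d (g * x)%g (g * y)%g < t -> t <= a * rad i -> d x y < a * rad i.+1.
Proof.
move=> hg hx hy xy ta; rewrite -(mulKg g x) -(mulKg g y).
by apply: lipl xy ta => //; exact: (lev_inv hS).
Qed.

Lemma cancelr g x y t a i : lev 30%N g -> lev 30%N (x * g)%g ->
  lev 30%N (y * g)%g ->
  d (x * g)%g (y * g)%g < t -> t <= a * rad i -> d x y < a * rad i.+1.
Proof.
move=> hg hx hy xy ta; rewrite -(mulgK g x) -(mulgK g y).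
by apply: lipr xy ta => //; exact: (lev_inv hS).
Qed.

Lemma canceli x y t a i : lev 30%N x -> lev 30%N y ->
  d x^-1%g y^-1%g < t -> t <= a * rad i -> d x y < a * rad i.+1.
Proof.
move=> hx hy xy ta; rewrite -(invgK x) -(invgK y).
by apply: lipi xy ta; exact: (lev_inv hS).
Qed.

(** This resets the radius to [delta]; [16 * rad 6] exceeds every radius that arises below. *)
Lemma covered_rad t Y m : Y `<=` lev 30%N -> t <= 16 * rad 6 ->
  covered t Y m -> covered delta Y (D * m).
Proof.
move=> hY ht cY; apply: (scale_doubling hS) => //.
by apply: covered_le cY; rewrite -mulrA.
Qed.

Lemma mulsetg_lev k l Y Z : Y `<=` lev k -> Z `<=` lev l ->
  mulsetg Y Z `<=` lev (k + l).
Proof. by move=> hY hZ _ [y /hY Yy [z /hZ Zz <-]]; exact: (lev_mul hS). Qed.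

Lemma invsetg_lev k Y : Y `<=` lev k -> invsetg Y `<=` lev k.
Proof. by move=> hY _ [y /hY Yy <-]; exact: (lev_inv hS). Qed.

(** It is enough to bound the separated subsets of [Y], because a maximal one is a net. *)
Lemma covered_count t Y n b : Y `<=` lev 30%N -> 0 < t -> t <= 16 * rad 6 ->
  (0 < n)%N ->
  (forall W, separated t W -> {in W, forall x, Y x} -> (size W * n <= b)%N) ->
  exists2 m, (m * n <= b)%N & covered delta Y (D * m).
Proof.
move=> hY t0 ht n0 h.
have [W [sW WY cW]] : exists s, [/\ separated t s, {in s, forall x, Y x} &
    covered t Y (size s)].
  apply: (@maximal_separated _ _ _ _ b) => // W sW WY.
  by apply: leq_trans (h W sW WY); rewrite leq_pmulr.
exists (size W); first exact: h.
exact: covered_rad cW.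
Qed.

(** The translate [a0 Y] lies in [A Y], and [a0] can be cancelled. This is how a leading [A] is
    removed from a product. *)
Lemma covered_mull A Y a0 q : A `<=` lev 1%N -> A a0 -> Y `<=` lev 14%N ->
  covered delta (mulsetg A Y) q -> covered delta Y (D * q).
Proof.
move=> hA Aa0 hY cAY; have La0 := hA _ Aa0.
have [w0 w1] := (rad0, rad_gt0 0).
have r16 : rad 1 <= rad 6 by exact: rad_le.
have r6 := rad_gt0 6.
apply: (@covered_rad (2 * rad 1)); [|lra|].
  by move=> y /hY Yy; lv.
apply: (covered_rel (rel := fun y x => x = a0 * y)%g cAY).
  by move=> y Yy; exists (a0 * y)%g => //; exists a0 => //; exists y.
move=> y y' _ _ Yy Yy' _ _ -> -> h.
have := hY _ Yy; have := hY _ Yy' => ly' ly.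
apply: (cancell (g := a0) _ _ _ h); [lv|lv|lv|lra].
Qed.

Lemma covered_mulr A Y b0 q : Y `<=` lev 1%N -> Y b0 -> A `<=` lev 14%N ->
  covered delta (mulsetg A Y) q -> covered delta A (D * q).
Proof.
move=> hY Yb0 hA cAY; have Lb0 := hY _ Yb0.
have [w0 w1] := (rad0, rad_gt0 0).
have r16 : rad 1 <= rad 6 by exact: rad_le.
have r6 := rad_gt0 6.
apply: (@covered_rad (2 * rad 1)); [|lra|].
  by move=> y /hA Yy; lv.
apply: (covered_rel (rel := fun y x => x = y * b0)%g cAY).
  by move=> y Ay; exists (y * b0)%g => //; exists y => //; exists b0.
move=> y y' _ _ Ay Ay' _ _ -> -> h.
have := hA _ Ay; have := hA _ Ay' => ly' ly.
apply: (cancelr (g := b0) _ _ _ h); [lv|lv|lv|lra].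
Qed.

Lemma covered_inv Y q : Y `<=` lev 14%N ->
  covered delta Y q -> covered delta (invsetg Y) (D * q).
Proof.
move=> hY cY.
have [w0 w1] := (rad0, rad_gt0 0).
have r16 : rad 1 <= rad 6 by exact: rad_le.
have r6 := rad_gt0 6.
apply: (@covered_rad (2 * rad 1)); [|lra|].
  by move=> _ [y /hY Yy <-]; lv.
apply: (covered_rel (rel := fun y x => y = x^-1)%g cY).
  by move=> _ [y Yy <-]; exists y.
move=> _ _ y y' _ _ /hY ly /hY ly' -> -> h.
apply: (lipi _ _ h); [lv|lv|lra].
Qed.

(** Both conditions are imposed to make the set symmetric, since inversion is only bi-Lipschitz. The
    radius is what a distance [2 * rad 0] becomes after one translation, as needed in
    [popular_group_covers]. *)
Definition unit_nbhs : set G :=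
  [set u | d 1%g u < 2 * rad 1 /\ d 1%g u^-1%g < 2 * rad 1].

Lemma unit_nbhs_lev : unit_nbhs `<=` lev 1%N.
Proof.
by move=> u [h _]; apply: (scale_small hS); rewrite -mulrA -(expr1 C).
Qed.

(** A point [a u y] is within [2 * rad 3] of [a y], so inserting the neighbourhood only enlarges the
    radius of the cover. *)
Lemma covered_unit_nbhs A Y q : A `<=` lev 1%N -> Y `<=` lev 13%N ->
  covered delta (mulsetg A Y) q ->
  covered delta (mulsetg A (mulsetg unit_nbhs Y)) (D * q).
Proof.
move=> hA hY cAY.
have [w0 w1] := (rad0, rad_gt0 0).
have r1 : rad 0 <= rad 3 by exact: rad_le.
have r3 : rad 3 <= rad 6 by exact: rad_le.
apply: (@covered_rad (6 * rad 3)); [|lra|].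
  by move=> _ [a /hA la [_ [u /unit_nbhs_lev lu [y /hY ly <-]] <-]]; lv.
apply: (covered_rel (rel := fun x z => d z x < 2 * rad 3) cAY).
  move=> _ [a Aa [_ [u Uu [y Yy <-]] <-]].
  have [[la lu] ly] := (hA _ Aa, unit_nbhs_lev Uu, hY _ Yy).
  exists (a * y)%g; first by exists a => //; exists y.
  have h1 : d (1 * y)%g (u * y)%g < 2 * rad 2.
    apply: (lipr _ _ _ Uu.1); [lv|lv|lv|lra].
  rewrite mul1g in h1.
  by apply: (lipl _ _ _ h1); [lv|lv|lv|lra].
move=> x x' z z' _ _ _ _ h h' zz'.
have := metric_triangle x z x'; have := metric_triangle z z' x'.
rewrite (metric_sym x z); lra.
Qed.

(* Ruzsa's triangle inequality: [(x y, z)] is recovered from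
   [(x z^-1, z y)]. *)
Lemma covered_triangle X Z Y (Z0 : seq G) p q :
  X `<=` lev 2%N -> Z `<=` lev 2%N -> Y `<=` lev 2%N ->
  separated (8 * rad 4) Z0 -> {in Z0, forall z, Z z} -> (0 < size Z0)%N ->
  covered delta (mulsetg X (invsetg Z)) p -> covered delta (mulsetg Z Y) q ->
  exists2 m, (m * size Z0 <= p * q)%N &
    covered delta (mulsetg X Y) (D * m).
Proof.
move=> hX hZ hY [uZ sZ] Z0Z Z0n cp cq.
have [w0 w1] := (rad0, rad_gt0 0).
have r01 : rad 0 <= rad 1 by exact: rad_le.
have r12 : rad 1 <= rad 2 by exact: rad_le.
have r24 : rad 2 <= rad 4 by exact: rad_le.
have r46 : rad 4 <= rad 6 by exact: rad_le.
apply: (@covered_count (8 * rad 4)) => //; [|lra|lra|].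
  by move=> _ [x /hX lx [y /hY ly <-]]; lv.
move=> W [uW sW] WXY.
have [c hc] : exists c : G -> G * G, forall w, w \in W ->
    [/\ X (c w).1, Y (c w).2 & ((c w).1 * (c w).2)%g = w].
  have /choice[c hc] : forall w, exists c : G * G, w \in W ->
      [/\ X c.1, Y c.2 & (c.1 * c.2)%g = w].
    move=> w; have [wW|/negP wW] := boolP (w \in W); last by exists (1, 1)%g.
    by have [x Xx [y Yy xy]] := WXY w wW; exists (x, y).
  by exists c.
rewrite -[(p * q)%N]mul1n.
apply: (@count_pairs _ _ G delta _ _ p q W (fun=> Z0)
  (fun w z => ((c w).1 * z^-1)%g) (fun w z => (z * (c w).2)%g) _ 1 cp cq uW).
- by move=> w _; rewrite mul1n.
- move=> w wW z zZ; have [h1 h2 _] := hc w wW; have Zz := Z0Z z zZ; split.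
    by exists (c w).1 => //; exists z^-1%g => //; exists z.
  by exists z => //; exists (c w).2.
move=> w w' z z' wW wW' zZ zZ' h1 h2.
have [/hX x1 /hY y1 e1] := hc w wW; have [/hX x2 /hY y2 e2] := hc w' wW'.
have [/hZ lz /hZ lz'] := (Z0Z z zZ, Z0Z z' zZ').
have k1 : d ((c w).1 * z^-1 * (z * (c w).2))%g
    ((c w).1 * z^-1 * (z' * (c w').2))%g < 2 * rad 1.
  apply: (lipl _ _ _ h2); [lv|lv|lv|lra].
have k2 : d ((c w).1 * z^-1 * (z' * (c w').2))%g
    ((c w').1 * z'^-1 * (z' * (c w').2))%g < 2 * rad 1.
  apply: (lipr _ _ _ h1); [lv|lv|lv|lra].
have e3 (v u t : G) : (v * t^-1 * (t * u) = v * u)%g by rewrite mulgA mulgVK.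
rewrite e3 e1 in k1; rewrite [((c w').1 * _ * _)%g]e3 e2 in k2.
have ww : w = w'.
  apply: sW => //.
  by have := metric_triangle w ((c w).1 * z^-1 * (z' * (c w').2))%g w'; lra.
split=> //; apply: sZ => //; rewrite -ww in h1.
have k3 : d z^-1%g z'^-1%g < 2 * rad 1.
  apply: (cancell (g := (c w).1) _ _ _ h1); [lv|lv|lv|lra].
have k4 : d z z' < 2 * rad 2.
  apply: (canceli _ _ k3); [lv|lv|lra].
lra.
Qed.

End Scale.

(** * Popular quotients of a separated set *)

Section Popular.
Variables (R : realType) (G : metricGroupType R) (lev : nat -> set G).
Variables (C delta : R) (D : nat) (hS : scale lev C delta D).
Variables (A : set G) (n : nat) (a : 'I_n -> G) (F : seq G).
Hypotheses (levA : A `<=` lev 1%N) (Aa : forall i, A (a i)).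
Hypothesis (sepa : forall i j,
  mdist (a i) (a j) < 8 * rad C delta 4 -> i = j).
Hypothesis (coverF : forall x y, A x -> A y ->
  exists2 c, c \in F & mdist c (x * y^-1)%g < delta).
Hypothesis (n_gt0 : (0 < n)%N).
Implicit Types (Y : set G) (x y : G).

Local Notation d := (@mdist R G).
Local Notation rad := (rad C delta).
Local Notation p := (size F).
Local Notation U := (@unit_nbhs R G C delta).

Lemma quotient_cell_subproof i j :
  (cell F delta (a i * (a j)^-1)%g < p)%N.
Proof. by apply/cell_size/coverF. Qed.

Definition quotient_cell i j : 'I_p := Ordinal (quotient_cell_subproof i j).

Lemma quotient_cell_close i j k l : quotient_cell i j = quotient_cell k l ->
  d (a i * (a j)^-1)%g (a k * (a l)^-1)%g < 2 * rad 0.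
Proof.
move=> /(congr1 val) /= h; rewrite (rad0 _ delta).
by apply: cell_close h; apply: coverF.
Qed.

Let lev_a i : lev 1%N (a i). Proof. exact/levA/Aa. Qed.

Let radii : [/\ 0 < rad 0, rad 0 <= rad 1, rad 1 <= rad 2, rad 2 <= rad 4 &
  rad 4 <= rad 6].
Proof. by split; [exact: (rad_gt0 hS)|apply: (rad_le hS)..]. Qed.

Lemma quotient_cell_inj i : injective (quotient_cell i).
Proof.
have [w0 r01 r12 r24 r46] := radii.
move=> j k /quotient_cell_close h; apply: sepa.
have [li [lj lk]] := (lev_a i, (lev_a j, lev_a k)).
have k1 : d (a j)^-1%g (a k)^-1%g < 2 * rad 1.
  by apply: (cancell hS (g := a i) _ _ _ h); [lv|lv|lv|lra].
have k2 : d (a j) (a k) < 2 * rad 2.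
  by apply: (canceli hS _ _ k1); [lv|lv|lra].
lra.
Qed.

Local Notation pop := (popular quotient_cell).

Definition popular_quotients : set G :=
  [set s | exists2 ca, ca \in pop & s = ((a ca.1)^-1 * a ca.2)%g].

Local Notation S := popular_quotients.

Lemma popular_quotients_lev : S `<=` lev 2%N.
Proof.
by move=> _ [[i j] _ ->] /=; have [li lj] := (lev_a i, lev_a j); lv.
Qed.

Lemma popular_quotientsV s : S s -> S s^-1%g.
Proof.
move=> [[i j] ij ->]; exists (j, i); first by rewrite popularC.
by rewrite /= invgM invgK.
Qed.

(* [S Y] grows [A Y] by little because each [a s y] factors through
   [(A A^-1) (A Y)] in as many ways as [s] has representations. *)
Lemma covered_popular Y q : Y `<=` lev 13%N ->
  covered delta (mulsetg A (invsetg A)) p ->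
  covered delta (mulsetg A Y) q ->
  exists2 m, (m * n ^ 2 <= 2 * p * (p * q))%N &
    covered delta (mulsetg A (mulsetg S Y)) (D * m).
Proof.
move=> hY cp cq.
have [w0 r01 r12 r24 r46] := radii.
apply: (covered_count hS (t := 8 * rad 4)); [|lra|lra|by rewrite expn_gt0 n_gt0|].
  move=> _ [x /levA lx [_ [s /popular_quotients_lev ls [y /hY ly <-]] <-]]; lv.
move=> W [uW sW] WASY.
have /choice[c hc] : forall w, exists c : G * ('I_n * 'I_n) * G, w \in W ->
    [/\ A c.1.1, c.1.2 \in pop, Y c.2 &
      (c.1.1 * ((a c.1.2.1)^-1 * a c.1.2.2 * c.2))%g = w].
  move=> w; have [wW|/negP wW] := boolP (w \in W); last first.
    by exists (1, (Ordinal n_gt0, Ordinal n_gt0), 1)%g.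
  have [x Ax [_ [_ [ij ijP ->] [y Yy <-]] e]] := WASY w wW.
  by exists (x, ij, y).
apply: (@count_pairs _ G _ delta _ _ p q W
  (fun w => enum (reps quotient_cell (c w).1.2.1 (c w).1.2.2))
  (fun w db => ((c w).1.1 * (a db.1)^-1)%g)
  (fun w db => (a db.2 * (c w).2)%g) _ _ cp cq uW).
- move=> w wW; split; first exact: enum_uniq.
  by rewrite -cardE; have [_ + _ _] := hc w wW; rewrite inE.
- move=> w wW [i j] _; have [h1 _ h2 _] := hc w wW; split.
    by exists (c w).1.1 => //; exists (a i)^-1%g => //; exists (a i).
  by exists (a j) => //; exists (c w).2.
move=> w w' [i j] [i' j'] wW wW'; rewrite !mem_enum !inE /= => /eqP e /eqP e' f1 f2.
(* Multiplying [a t a l^-1 ~ a s a k^-1] by [a l], [(a s)^-1], [y] and [x] in turn takes four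
   Lipschitz steps, whence [rad 4]. *)
have close v k l : v \in W ->
    quotient_cell (c v).1.2.2 l = quotient_cell (c v).1.2.1 k ->
    d v ((c v).1.1 * (a k)^-1 * (a l * (c v).2))%g < 2 * rad 4.
  move=> vW /quotient_cell_close h.
  have [/levA lx _ /hY ly ev] := hc v vW.
  rewrite -[X in d X _]ev {ev}.
  set x := (c v).1.1 in lx *; set y := (c v).2 in ly *.
  set s := (c v).1.2.1 in h *; set t := (c v).1.2.2 in h *.
  have [[ls lt] [lk ll]] := ((lev_a s, lev_a t), (lev_a k, lev_a l)).
  have k1 : d (a t)%g (a s * (a k)^-1 * a l)%g < 2 * rad 1.
    rewrite -{1}(mulgVK (a l) (a t)).
    by apply: (lipr hS _ _ _ h); [lv|lv|lv|lra].
  have k2 : d ((a s)^-1 * a t)%g ((a k)^-1 * a l)%g < 2 * rad 2.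
    have -> : ((a k)^-1 * a l = (a s)^-1 * (a s * (a k)^-1 * a l))%g.
      by rewrite !mulgA mulVg mul1g.
    by apply: (lipl hS _ _ _ k1); [lv|lv|lv|lra].
  have k3 : d ((a s)^-1 * a t * y)%g ((a k)^-1 * a l * y)%g < 2 * rad 3.
    by apply: (lipr hS _ _ _ k2); [lv|lv|lv|lra].
  have -> : (x * (a k)^-1 * (a l * y) = x * ((a k)^-1 * a l * y))%g.
    by rewrite !mulgA.
  by apply: (lipl hS _ _ _ k3); [lv|lv|lv|lra].
have c1 := close w _ _ wW e; have c2 := close w' _ _ wW' e'.
have [lx ly] : lev 1%N (c w).1.1 /\ lev 13%N (c w).2.
  by have [/levA ? _ /hY ? _] := hc w wW.
have [lx' ly'] : lev 1%N (c w').1.1 /\ lev 13%N (c w').2.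
  by have [/levA ? _ /hY ? _] := hc w' wW'.
have [[li lj] [li' lj']] := ((lev_a i, lev_a j), (lev_a i', lev_a j')).
have k1 : d ((c w).1.1 * (a i)^-1 * (a j * (c w).2))%g
    ((c w).1.1 * (a i)^-1 * (a j' * (c w').2))%g < 2 * rad 1.
  by rewrite -(rad0 C delta) in f2; apply: (lipl hS _ _ _ f2); [lv|lv|lv|lra].
have k2 : d ((c w).1.1 * (a i)^-1 * (a j' * (c w').2))%g
    ((c w').1.1 * (a i')^-1 * (a j' * (c w').2))%g < 2 * rad 1.
  by rewrite -(rad0 C delta) in f1; apply: (lipr hS _ _ _ f1); [lv|lv|lv|lra].
(* Two errors [2 * rad 4] and two errors [2 * rad 1] sum to at most [8 * rad 4]: this is the origin
   of the separation imposed on [W]. *)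
have ww : w = w'.
  apply: sW => //.
  have := metric_triangle w ((c w).1.1 * (a i)^-1 * (a j * (c w).2))%g w'.
  have := metric_triangle ((c w).1.1 * (a i)^-1 * (a j * (c w).2))%g
    ((c w).1.1 * (a i)^-1 * (a j' * (c w').2))%g w'.
  have := metric_triangle ((c w).1.1 * (a i)^-1 * (a j' * (c w').2))%g
    ((c w').1.1 * (a i')^-1 * (a j' * (c w').2))%g w'.
  rewrite (metric_sym w') in c2; lra.
split=> //; move: f1 e'; rewrite -ww => f1.
have k3 : d (a i)^-1%g (a i')^-1%g < 2 * rad 1.
  rewrite -(rad0 C delta) in f1.
  by apply: (cancell hS (g := (c w).1.1) _ _ _ f1); [lv|lv|lv|lra].
have k4 : d (a i) (a i') < 2 * rad 2.
  by apply: (canceli hS _ _ k3); [lv|lv|lra].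
have ii : i = i' by apply: sepa; lra.
(* Once [i] is known, [j] is fixed by the cell that it must share with [i]. *)
rewrite -ii -e => e'; congr pair.
exact/esym/(quotient_cell_inj e').
Qed.

(** For fixed [i] the points [(a i)^-1 * a j] are far apart, so a popular pair is determined by [i]
    and the cell of its quotient. Hence there are at most [n * size S0] popular pairs, to be
    compared with [popular_large]. *)
Lemma popular_quotients_large :
  exists S0, [/\ separated (2 * rad 1) S0, {in S0, forall s, S s},
    (0 < size S0)%N & (n ^ 2 <= 2 * p * size S0)%N].
Proof.
have [w0 r01 r12 r24 r46] := radii.
have [S0 [sepS S0S covS]] : exists s, [/\ separated (2 * rad 1) s,
    {in s, forall x, S x} & covered (2 * rad 1) S (size s)].
  apply: (@maximal_separated _ _ _ _
    (size [seq ((a ca.1)^-1 * a ca.2)%g | ca <- enum pop])); first lra.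
  move=> s [us _] sS; apply: uniq_leq_size => // x /sS[ca cap ->].
  by apply/mapP; exists ca; rewrite ?mem_enum.
have [H HS0 HS] := covS.
have le : (#|pop| <= n * size S0)%N.
  pose f (ca : 'I_n * 'I_n) :=
    ((ca.1 : nat), cell H (2 * rad 1) ((a ca.1)^-1 * a ca.2)%g).
  rewrite cardE -(size_map f).
  apply: (@leq_trans (size [seq (i, j) | i <- iota 0 n, j <- iota 0 (size S0)])).
    apply: uniq_leq_size.
      rewrite map_inj_in_uniq ?enum_uniq // => -[i j] [i' j'].
      rewrite !mem_enum => ijP ijP' [/val_inj ii]; rewrite -ii /= => h.
      congr pair; apply: sepa; have [[li lj] lj'] := ((lev_a i, lev_a j), lev_a j').
      rewrite -ii in ijP'.
      have k1 : d ((a i)^-1 * a j)%g ((a i)^-1 * a j')%g < 4 * rad 1.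
        have -> : 4 * rad 1 = 2 * (2 * rad 1) by ring.
        apply: cell_close h; apply: HS.
          by exists (i, j).
        by exists (i, j').
      have k2 : d (a j) (a j') < 4 * rad 2.
        by apply: (cancell hS (g := (a i)^-1%g) _ _ _ k1); [lv|lv|lv|lra].
      lra.
    move=> x /mapP[[i j]]; rewrite mem_enum => ijP ->{x}.
    apply/allpairsP; exists (f (i, j)); rewrite !mem_iota /= !add0n ltn_ord.
    split=> //; apply: leq_trans HS0; apply/cell_size/HS.
    by exists (i, j).
  by rewrite size_allpairs !size_iota.
have := popular_large quotient_cell_inj => big.
have h : (n ^ 2 <= 2 * p * size S0)%N.
  rewrite -(leq_pmul2l n_gt0) -expnS; apply: leq_trans big _.
  by rewrite mulnCA leq_mul2l le orbT.
exists S0; split=> //; rewrite lt0n; apply: contraTneq h => ->.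
by rewrite muln0 leqn0 expn_eq0 andbT -lt0n.
Qed.

(** The middle factor makes the set open and absorbs errors: when [x S] and [y S] only nearly meet,
    [y] lies in [x S U S] rather than in [x S S]. *)
Definition popular_group : set G := mulsetg S (mulsetg U S).

Local Notation H := popular_group.

Lemma popular_group_lev : H `<=` lev 5%N.
Proof.
move=> _ [s /popular_quotients_lev ls [_ [u /(unit_nbhs_lev hS) lu
  [t /popular_quotients_lev lt <-]] <-]]; lv.
Qed.

Lemma popular_groupV : invsetg H = H.
Proof.
have HV x : H x -> H x^-1%g.
  move=> [s Ss [_ [u [u1 u2] [t St <-]] <-]].
  exists t^-1%g; first exact: popular_quotientsV.
  exists (u^-1 * s^-1)%g; last by rewrite !invgM !mulgA.
  exists u^-1%g; first by split=> //; rewrite invgK.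
  by exists s^-1%g => //; exact: popular_quotientsV.
apply/seteqP; split=> [_ [x /HV Hx <-]//|x Hx].
by exists x^-1%g; [exact: HV|rewrite invgK].
Qed.

(* Ruzsa's covering lemma. *)
Lemma popular_group_covers Y (S0 : seq G) q : Y `<=` lev 10%N ->
  separated (2 * rad 1) S0 -> {in S0, forall s, S s} -> (0 < size S0)%N ->
  covered delta (mulsetg Y S) q ->
  exists X : seq G, [/\ {in X, forall x, Y x}, (size X * size S0 <= q)%N &
    forall y, Y y -> exists2 x, x \in X & exists2 h, H h & y = (x * h)%g].
Proof.
move=> hY [uS sS] S0S S0n cq.
have [w0 r01 r12 r24 r46] := radii.
have hSl := popular_quotients_lev.
(* The translates [x S] and [y S] nearly meet; [2 * rad 0] is the distance within which two points
   of a common cell lie. *)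
pose e x y := exists s t, [/\ S s, S t & d (x * s)%g (y * t)%g < 2 * rad 0].
have cnt X : indep e X -> {in X, forall x, Y x} -> (size X * size S0 <= q)%N.
  move=> [uX iX] XY.
  (* The products [x * s] alone determine [x] and [s], so the second cover in [count_pairs] is
     trivial. *)
  have c1 : covered delta [set 1%g : G] 1.
    exists [:: 1%g] => // _ ->; exists 1%g; first by rewrite mem_head.
    by rewrite mdistxx; exact: (scale_delta hS).
  rewrite -[q]muln1 -[leqRHS]mul1n.
  apply: (@count_pairs _ _ G delta _ _ q 1 X (fun=> S0)
    (fun x s => x * s)%g (fun _ _ => 1%g) _ _ cq c1 uX).
  - by move=> x _; rewrite mul1n.
  - move=> x xX s sS0; split=> //; exists x; first exact: XY.
    by exists s => //; exact: S0S.
  move=> x x' s s' xX xX' sS0 sS0' h _; rewrite -(rad0 C delta) in h.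
  have xx : x = x'.
    by apply: iX => //; exists s, s'; split=> //; exact: S0S.
  split=> //; apply: sS => //; rewrite -xx in h.
  have [lx [ls ls']] := (hY _ (XY x xX), (hSl _ (S0S s sS0), hSl _ (S0S s' sS0'))).
  by apply: (cancell hS (g := x) _ _ _ h); [lv|lv|lv|lra].
have [s0 s0S0] : exists s0, s0 \in S0.
  by case: (S0) S0n => // s0 ? _; exists s0; rewrite mem_head.
have [| |X iX XY|X [iX XY XX]] := @maximal_indep _ e Y q.
- move=> x Yx; exists s0, s0; split; [exact: S0S|exact: S0S|].
  rewrite mdistxx; lra.
- by move=> x y [s [t [Ss St h]]]; exists t, s; split=> //; rewrite metric_sym.
- by apply: leq_trans (cnt X iX XY); rewrite leq_pmulr.
exists X; split=> // [|y Yy]; first exact: cnt.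
have [x xX [s [t [Ss St h]]]] := XX y Yy; exists x => //.
have [[lx ly] [ls lt]] := ((hY _ (XY x xX), hY _ Yy), (hSl _ Ss, hSl _ St)).
(* The factor [(x s)^-1 (y t)] between [s] and [t^-1] is close to [1], and so is its inverse,
   because [x s] and [y t] are close. *)
exists (s * ((x * s)^-1 * (y * t) * t^-1))%g; last first.
  by rewrite !mulgA mulgV mul1g mulgK.
exists s => //; exists ((x * s)^-1 * (y * t) * t^-1)%g => //.
exists ((x * s)^-1 * (y * t))%g; last first.
  by exists t^-1%g => //; exact: popular_quotientsV.
split.
  rewrite -(mulVg (x * s)%g).
  by apply: (lipl hS _ _ _ h); [lv|lv|lv|lra].
rewrite invgM invgK -(mulVg (y * t)%g).
rewrite (metric_sym (x * s)%g) in h.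
by apply: (lipl hS _ _ _ h); [lv|lv|lv|lra].
Qed.

End Popular.

(** * The approximate group at a fixed scale *)

Lemma leq_monomial (k D a b c a' b' c' : nat) : (0 < k)%N -> (0 < D)%N ->
  (a <= a')%N -> (b <= b')%N -> (c <= c')%N ->
  (2 ^ a * k ^ b * D ^ c <= 2 ^ a' * k ^ b' * D ^ c')%N.
Proof. by move=> k0 D0 aa bb cc; rewrite !leq_mul // leq_pexp2l. Qed.

(** The constant [E] comes from the longest product, [H H S = S U S S U S S]. Its five factors [S]
    cost [2 k ^ 2 D] each; the two factors [U], the initial cover of [A] and the removal of the
    leading [A] cost one [D] each; comparing [S0] with [A0] costs [2 k]. *)
Lemma approximate_group_core (R : realType) (G : metricGroupType R)
    (lev : nat -> set G) (C delta : R) (D : nat) (hS : scale lev C delta D)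
    (A B : set G) (k : nat) (A0 : seq G) :
  (0 < k)%N -> (0 < D)%N -> A `<=` lev 1%N -> B `<=` lev 1%N ->
  separated (8 * rad C delta 4) A0 -> {in A0, forall x, A x} ->
  (0 < size A0)%N -> covered delta A (D * size A0) ->
  covered delta (mulsetg A (invsetg A)) (k * size A0) ->
  covered delta (mulsetg A B) (k * size A0) ->
  let E := (2 ^ 6 * k ^ 11 * D ^ 9)%N in
  exists S : set G, let H := mulsetg S (mulsetg (@unit_nbhs R G C delta) S) in
  [/\ S !=set0, invsetg H = H, H `<=` lev 5%N & covered delta H (E * size A0)] /\
  exists X1 X2 X3 : seq G,
    [/\ {in X1, forall x, mulsetg H H x},
        (size X1 <= E)%N /\ (size X2 <= E)%N /\ (size X3 <= E)%N,
        {in X2, forall x, A x} /\ {in X3, forall x, B x} &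
        [/\ mulsetg H H `<=` mulsetg [set` X1] H,
            A `<=` mulsetg [set` X2] H & B `<=` mulsetg H [set` X3]]].
Proof.
move=> k0 D0 levA levB sA0 A0A n0 cA [F sF hF] cAB E.
set n := size A0 in n0 cA sF cAB E *.
pose a (i : 'I_n) := nth 1%g A0 i.
have Aa i : A (a i) by apply: A0A; rewrite mem_nth.
have sepa i j : mdist (a i) (a j) < 8 * rad C delta 4 -> i = j.
  case: sA0 => uA0 sA0 h; apply/val_inj/eqP.
  have /eqP := sA0 (a i) (a j) (mem_nth _ (ltn_ord i)) (mem_nth _ (ltn_ord j)) h.
  by rewrite nth_uniq // ltn_ord.
have coverF x y : A x -> A y ->
    exists2 c, c \in F & mdist c (x * y^-1)%g < delta.
  by move=> Ax Ay; apply: hF; exists x => //; exists y^-1%g => //; exists y.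
have cp : covered delta (mulsetg A (invsetg A)) (size F) by exists F.
pose S := popular_quotients Aa coverF; exists S => H.
pose U := @unit_nbhs R G C delta.
have levS : S `<=` lev 2%N by apply: (popular_quotients_lev hS levA).
have levU : U `<=` lev 1%N := unit_nbhs_lev hS.
have levH : H `<=` lev 5%N by apply: (popular_group_lev hS levA).
have HV : invsetg H = H := popular_groupV C Aa coverF.
have lev_mulset (i j l : nat) (Y Z : set G) : Y `<=` lev i -> Z `<=` lev j ->
    (i + j <= l)%N -> mulsetg Y Z `<=` lev l.
  by move=> hY hZ le; apply: subset_trans (lev_le hS le); exact: (mulsetg_lev hS).
have stepS i Y q : Y `<=` lev i -> (i <= 11)%N ->
    covered delta (mulsetg A Y) q -> mulsetg S Y `<=` lev i.+2 /\
    covered delta (mulsetg A (mulsetg S Y)) (D * (2 * k ^ 2 * q)).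
  move=> hY i11 cq; split; first exact: (lev_mulset 2 i).
  have hY13 : Y `<=` lev 13%N.
    by apply: subset_trans hY _; apply: (lev_le hS); lia.
  have [m mn cm] := covered_popular hS levA Aa sepa coverF n0 hY13 cp cq.
  apply: covered_leq cm; rewrite leq_mul2l; apply/orP; right.
  have nn : (0 < n ^ 2)%N by rewrite expn_gt0 n0.
  rewrite -(leq_pmul2r nn); apply: leq_trans mn _.
  apply: (@leq_trans (2 * (k * n) * ((k * n) * q))%N).
    by rewrite !leq_mul.
  by rewrite -!mulnn; lia.
have stepU i Y q : Y `<=` lev i -> (i <= 11)%N ->
    covered delta (mulsetg A Y) q -> mulsetg U Y `<=` lev i.+1 /\
    covered delta (mulsetg A (mulsetg U Y)) (D * q).
  move=> hY i11 cq; split; first exact: (lev_mulset 1 i).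
  apply: (covered_unit_nbhs hS levA) => //.
  by apply: subset_trans hY _; apply: (lev_le hS); lia.
have l1 : [set 1%g : G] `<=` lev 0%N by move=> _ ->; exact: (lev_1 hS).
have c0 : covered delta (mulsetg A [set 1%g]) (D * n).
  by apply: covered_sub cA => _ [x Ax [_ -> <-]]; rewrite mulg1.
(* The products [A S U S S U S S] and, in [e2] and [e3], [A S U S] are built from the right. *)
have [S1 c1] := stepS _ _ _ l1 isT c0.
have [S2 c2] := stepS _ _ _ S1 isT c1.
have [S3 c3] := stepU _ _ _ S2 isT c2.
have [S4 c4] := stepS _ _ _ S3 isT c3.
have [S5 c5] := stepS _ _ _ S4 isT c4.
have [S6 c6] := stepU _ _ _ S5 isT c5.
have [S7 c7] := stepS _ _ _ S6 isT c6.
have [T2 e2] := stepU _ _ _ S1 isT c1.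
have [T3 e3] := stepS _ _ _ T2 isT e2.
have Aa0 := Aa (Ordinal n0).
have S1E Y : mulsetg Y [set 1%g] = Y.
  apply/seteqP; split=> [_ [x Yx [_ -> <-]]|x Yx]; first by rewrite mulg1.
  by exists x => //; exists 1%g => //; rewrite mulg1.
rewrite S1E in c1 S1 c2 c3 c4 c5 c6 c7 S2 S3 S4 S5 S6 S7 T2 e2 T3 e3.
have to14 i Y : Y `<=` lev i -> (i <= 14)%N -> Y `<=` lev 14%N.
  by move=> hY i14; apply: subset_trans hY (lev_le hS i14).
have cH := covered_mull hS levA Aa0 (to14 _ _ T3 isT) e3.
have cHHS := covered_mull hS levA Aa0 (to14 _ _ S7 isT) c7.
have [S0 [sepS0 S0S s0 big]] :=
  popular_quotients_large hS levA Aa sepa coverF n0.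
have small : (n <= 2 * k * size S0)%N.
  rewrite -(leq_pmul2l n0) mulnn; apply: leq_trans big _.
  by apply: (@leq_trans (2 * (k * n) * size S0)); [rewrite !leq_mul | lia].
have cover Y q : Y `<=` lev 10%N -> covered delta (mulsetg Y S) (q * n) ->
    (2 * k * q <= E)%N ->
    exists X : seq G, [/\ {in X, forall x, Y x}, (size X <= E)%N &
      Y `<=` mulsetg [set` X] H].
  move=> hY cq qE.
  have [X [XY sX YX]] := popular_group_covers hS levA hY sepS0 S0S s0 cq.
  exists X; split=> //; last first.
    by move=> y /YX[x xX [h Hh ->]]; exists x => //; exists h.
  rewrite -(leq_pmul2r s0); apply: leq_trans sX _.
  apply: (@leq_trans (2 * k * q * size S0)%N); last by rewrite leq_mul2r qE orbT.
  by apply: (@leq_trans (q * (2 * k * size S0))%N);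
    [rewrite leq_mul2l small orbT | lia].
split.
  split=> //; last first.
    apply: covered_leq cH; rewrite [leqLHS](_ : _ = (2 ^ 2 * k ^ 4 * D ^ 5) * n)%N.
      by rewrite leq_mul2r leq_monomial ?orbT.
    ring.
  have s0' : size S0 != 0%N by rewrite -lt0n.
  by exists (nth 1%g S0 0); apply: S0S; rewrite mem_nth.
have [|||X1 [X1H sX1 hX1]] := cover (mulsetg H H) (2 ^ 5 * k ^ 10 * D ^ 9)%N.
- by apply: (lev_mulset 5 5).
- apply: covered_leq (covered_sub _ cHHS); last first.
    move=> _ [_ [_ [s Ss [_ [u Uu [t St <-]] <-]]
      [_ [s' Ss' [_ [u' Uu' [t' St' <-]] <-]] <-]] [r Sr <-]].
    exists s => //; exists (u * (t * (s' * (u' * (t' * r)))))%g; last by rewrite !mulgA.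
    exists u => //; exists (t * (s' * (u' * (t' * r))))%g => //.
    exists t => //; exists (s' * (u' * (t' * r)))%g => //.
    exists s' => //; exists (u' * (t' * r))%g => //.
    exists u' => //; exists (t' * r)%g => //.
    by exists t' => //; exists r.
  rewrite [leqLHS](_ : _ = (2 ^ 5 * k ^ 10 * D ^ 9) * n)%N //; ring.
- rewrite [leqLHS](_ : _ = 2 ^ 6 * k ^ 11 * D ^ 9)%N //; ring.
have [|||X2 [X2A sX2 hX2]] := cover A (2 * k ^ 2 * D ^ 2)%N.
- exact: subset_trans levA (lev_le hS _).
- apply: covered_leq c1.
  rewrite [leqLHS](_ : _ = (2 * k ^ 2 * D ^ 2) * n)%N //; ring.
- rewrite [leqLHS](_ : _ = 2 ^ 2 * k ^ 3 * D ^ 2)%N; first exact: leq_monomial.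
  ring.
(* The covering lemma puts the finite set on the left, so it is applied to [B^-1] and inverted
   afterwards. The product [B^-1 S] is bounded by the triangle inequality through [A], using
   [B^-1 A^-1 = (A B)^-1]. *)
have [|||X3 [X3B sX3 hX3]] := cover (invsetg B) (2 * k ^ 3 * D ^ 4)%N.
- exact: subset_trans (invsetg_lev hS levB) (lev_le hS _).
- have lev12 Y : Y `<=` lev 1%N -> Y `<=` lev 2%N.
    by move=> hY; apply: subset_trans hY (lev_le hS _).
  have cBA : covered delta (mulsetg (invsetg B) (invsetg A)) (D * (k * n)).
    apply: covered_sub (covered_inv hS _ cAB); last first.
      exact: to14 (mulsetg_lev hS levA levB) _.
    move=> _ [_ [b Bb <-] [_ [x Ax <-] <-]]; exists (x * b)%g; last by rewrite invgM.
    by exists x => //; exists b.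
  have [m mn cm] := covered_triangle hS (lev12 _ (invsetg_lev hS levB))
    (lev12 _ levA) levS sA0 A0A n0 cBA c1.
  apply: covered_leq cm.
  have mn' : (m <= D * k * (D * (2 * k ^ 2 * D)) * n)%N.
    rewrite -(leq_pmul2r n0); apply: leq_trans mn _.
    rewrite [leqLHS](_ : _ = (D * k * (D * (2 * k ^ 2 * D)) * n) * n)%N //; ring.
  apply: (@leq_trans (D * (D * k * (D * (2 * k ^ 2 * D)) * n))%N).
    by rewrite leq_mul2l mn' orbT.
  rewrite [leqLHS](_ : _ = (2 * k ^ 3 * D ^ 4) * n)%N //; ring.
- rewrite [leqLHS](_ : _ = 2 ^ 2 * k ^ 4 * D ^ 4)%N; first exact: leq_monomial.
  ring.
exists X1, X2, [seq x^-1%g | x <- X3]; split=> //.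
- by rewrite size_map.
- split=> // _ /mapP[x xX3 ->].
  by have [b Bb <-] := X3B x xX3; rewrite invgK.
split=> // b Bb.
have [x xX3 [h Hh e]] : mulsetg [set` X3] H b^-1%g by apply: hX3; exists b.
exists h^-1%g; first by rewrite -HV; exists h.
exists x^-1%g; last by rewrite -invgM e invgK.
by apply/mapP; exists x.
Qed.

(** * Volumes of balls and metric doubling *)

Section BallMeasure.
Variables (R : realType) (G : metricGroupType R).
Variables (mu : {measure set (borel G) -> \bar R}) (hG : locally_reasonable mu).
Implicit Types (x y z g h : G) (r : R).

Local Notation d := (@mdist R G).

Definition cball r : set G := [set y | d 1%g y <= r].

Lemma cball_le r r' : r <= r' -> cball r `<=` cball r'.
Proof. by move=> rr y /le_trans; apply. Qed.

Lemma open_ball x r : open (ball x r).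
Proof.
rewrite openE => y; rewrite ballEmdist /= => xy; apply/nbhs_ballP.
exists (r - d x y) => /=; first by rewrite subr_gt0.
move=> z; rewrite !ballEmdist /= => yz.
by have := metric_triangle x y z; lra.
Qed.

Lemma measurable_open (U : set G) : open U -> measurable (U : set (borel G)).
Proof. by move=> oU; apply: sub_sigma_algebra. Qed.

Lemma measurable_cball r : measurable (cball r : set (borel G)).
Proof.
rewrite -(setCK (cball r)); apply: (@measurableC _ (borel G)).
apply: measurable_open.
rewrite openE => y ny; apply/nbhs_ballP.
have xy : r < d 1%g y by rewrite ltNge; apply/negP => h; apply: ny.
exists (d 1%g y - r) => /=; first by rewrite subr_gt0.
move=> z; rewrite ballEmdist /= => yz; rewrite /cball /= => h.
by have := metric_triangle 1%g z y; rewrite (metric_sym z); lra.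
Qed.

Lemma le_mu (A B : set (borel G)) : measurable A -> measurable B ->
  A `<=` B -> (mu A <= mu B)%E.
Proof. by move=> mA mB AB; apply: le_measure; rewrite ?inE. Qed.

Lemma mulg_continuous2 g h : continuous (fun y : G => g * y * h)%g.
Proof.
have mc := mulg_continuous (lr_multiplicative hG).
move=> y; apply: (@continuous2_cvg _ _ _ _ _ _ (fun y => g * y)%g (fun=> h)
  (fun a b : G => a * b)%g (g * y)%g h).
- exact: (mc (g * y, h)%g).
- apply: (@continuous2_cvg _ _ _ _ _ _ (fun=> g) (fun y => y)
    (fun a b : G => a * b)%g g y); last exact: cvg_id.
    exact: (mc (g, y)).
  exact: cvg_cst.
- exact: cvg_cst.
Qed.

Lemma open_translate g h (U : set G) : open U ->
  open [set y | U (g * y * h)%g].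
Proof. by move: U; apply/continuousP; exact: mulg_continuous2. Qed.

Lemma open_mull g (U : set G) : open U -> open (mulsetg [set g] U).
Proof.
move=> oU; suff -> : mulsetg [set g] U = [set y | U (g^-1 * y * 1)%g].
  exact: open_translate.
apply/seteqP; split=> [_ [_ -> [y Uy <-]] /=|y /=]; first by rewrite mulg1 mulKg.
by rewrite mulg1 => Uy; exists g => //; exists (g^-1 * y)%g => //; rewrite mulVKg.
Qed.

Lemma lipschitz r : exists2 C : R, 1 <= C & forall x y g,
  cball r x -> cball r y -> cball r g ->
  [/\ d (g * x)%g (g * y)%g <= C * d x y,
      d (x * g)%g (y * g)%g <= C * d x y & d x^-1%g y^-1%g <= C * d x y].
Proof.
have [C C0 hC] := lr_lipschitz hG (@lr_closed_ball _ _ _ hG 1%g r).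
have CM x y : C * d x y <= Num.max 1 C * d x y.
  by rewrite ler_wpM2r ?mdist_ge0 // le_max lexx orbT.
exists (Num.max 1 C); first by rewrite le_max lexx.
move=> x y g hx hy hg.
by have [/andP[_ h1] /andP[_ h2] /andP[_ h3]] := hC x y g hx hy hg; split;
  apply: le_trans (CM x y).
Qed.

Definition vol r : R := fine (mu (ball (1%g : G) r)).

Lemma mu_ball r : mu (ball (1%g : G) r) = (vol r)%:E.
Proof.
rewrite /vol fineK // ge0_fin_numE ?measure_ge0 //.
apply: (@le_lt_trans _ _ (mu (cball r))).
  apply: le_mu.
  - by apply: measurable_open; exact: open_ball.
  - exact: measurable_cball.
  - by move=> y; rewrite ballEmdist => /ltW.
exact: (radon_compact (haar_radon (lr_multiplicative hG)) (@lr_closed_ball _ _ _ hG 1%g r)).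
Qed.

Lemma vol_gt0 r : 0 < r -> 0 < vol r.
Proof.
move=> r0; rewrite -lte_fin -mu_ball.
apply: (haar_gt0 (lr_multiplicative hG)); first exact: open_ball.
by exists 1%g; rewrite ballEmdist /= mdistxx.
Qed.

Lemma vol_doubling r1 : exists2 c : R, 1 <= c & forall j r, 0 < r ->
  2 ^+ j * r <= r1 -> vol (2 ^+ j * r) <= c ^+ j * vol r.
Proof.
(* Adding [1] makes the bound positive and keeps every intermediate radius strictly below it. *)
have [c hc] := @lr_doubling _ _ _ hG (`|r1| + 1) ltac:(exact: ltr_wpDl).
exists (Num.max 1 c); first by rewrite le_max lexx.
elim=> [|j IH] r r0; first by rewrite !expr0 !mul1r.
rewrite exprS -mulrA => h.
have p0 : 0 < 2 ^+ j * r by rewrite mulr_gt0 // exprn_gt0.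
have := ler_norm r1 => nr.
have := hc (2 ^+ j * r) p0 ltac:(lra).
rewrite !mu_ball -EFinM lee_fin => h1; apply: le_trans h1 _.
have h2 : vol (2 ^+ j * r) <= Num.max 1 c ^+ j * vol r by apply: IH => //; lra.
rewrite [_ ^+ j.+1]exprS -mulrA; apply: (@le_trans _ _ (Num.max 1 c * vol (2 ^+ j * r))).
  by rewrite ler_wpM2r ?le_max ?lexx ?orbT // ltW // vol_gt0.
by rewrite ler_wpM2l // le_max ler01.
Qed.

(** The translate by [z] of the ball of radius [r'] about [1] lies in [ball z r], and the measure is
    left invariant. *)
Lemma ball_mull_sub z r r' (C : R) : 0 < r' -> 1 <= C -> C * r' <= r ->
  (forall w, d 1%g w < r' -> d (z * 1)%g (z * w)%g <= C * d 1%g w) ->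
  ((vol r')%:E <= mu (ball z r))%E.
Proof.
move=> r0 C1 Cr hz.
rewrite -mu_ball -(haar_mull (lr_multiplicative hG) z); last first.
  by apply: measurable_open; exact: open_ball.
apply: le_mu.
- by apply: measurable_open; apply: open_mull; exact: open_ball.
- by apply: measurable_open; exact: open_ball.
move=> _ [_ -> [w + <-]]; rewrite !ballEmdist /= => w1.
have := hz w w1; rewrite mulg1 => h; apply: le_lt_trans h _.
by apply: lt_le_trans Cr; rewrite ltr_pM2l //; lra.
Qed.

Lemma ball_mull_sup z r r' (C : R) : 0 < r -> 1 <= C -> C * r <= r' ->
  (forall y, d z y < r -> d (z^-1 * z)%g (z^-1 * y)%g <= C * d z y) ->
  (mu (ball z r) <= (vol r')%:E)%E.
Proof.
move=> r0 C1 Cr hz.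
rewrite -mu_ball -(haar_mull (lr_multiplicative hG) z (A := ball 1%g r')); last first.
  by apply: measurable_open; exact: open_ball.
apply: le_mu.
- by apply: measurable_open; exact: open_ball.
- by apply: measurable_open; apply: open_mull; exact: open_ball.
move=> y; rewrite ballEmdist /= => zy; exists z => //.
exists (z^-1 * y)%g; last by rewrite mulVKg.
rewrite ballEmdist /=; have := hz y zy; rewrite mulVg => h; apply: le_lt_trans h _.
by apply: lt_le_trans Cr; rewrite ltr_pM2l //; lra.
Qed.

Lemma disjoint_balls (s : seq G) r (v : R) (V : set G) : separated (2 * r) s ->
  open V -> {in s, forall z, ball z r `<=` V} ->
  {in s, forall z, (v%:E <= mu (ball z r))%E} ->
  (((size s)%:R * v)%:E <= mu V)%E.
Proof.
move=> [us ss] oV sV sv.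
pose W (t : seq G) : set G := [set y | exists2 z, z \in t & ball z r y].
have oW t : open (W t).
  have -> : W t = \bigcup_(z in [set` t]) ball z r.
    by apply/seteqP; split=> y [z zt zy]; exists z.
  by apply: bigcup_open => z _; exact: open_ball.
suff h : (((size s)%:R * v)%:E <= mu (W s))%E.
  apply: le_trans h _; apply: le_mu; try exact: measurable_open.
  by move=> y [z /sV zV /zV].
elim: s us ss sv {sV} => [|z s IH] /= us ss sv; first by rewrite mul0r measure_ge0.
have /andP[zs us'] := us.
have -> : W (z :: s) = ball z r `|` W s.
  apply/seteqP; split=> y.
    by move=> [x]; rewrite inE => /orP[/eqP->|xs] h; [left|right; exists x].
  move=> [h|[x xs h]]; first by exists z => //; rewrite mem_head.
  by exists x => //; rewrite inE xs orbT.
have mW : measurable (W s : set (borel G)) by exact: measurable_open.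
have mB : measurable (ball z r : set (borel G)) by apply: measurable_open; exact: open_ball.
have -> : mu (ball z r `|` W s) = (mu (ball z r) + mu (W s))%E.
  apply: (@measureU _ _ (borel G) mu) => //.
  rewrite -subset0 => y [+ [x xs]]; rewrite !ballEmdist /= => h1 h2.
  suff e : z = x by rewrite e xs in zs.
  apply: ss; rewrite ?mem_head ?inE ?xs ?orbT //.
  by have := metric_triangle z y x; rewrite (metric_sym y); lra.
rewrite -natr1 mulrDl mul1r addrC EFinD; apply: leeD.
  by apply: sv; rewrite mem_head.
apply: IH => //.
  by move=> x y xs ys; apply: ss; rewrite inE ?xs ?ys orbT.
by move=> x xs; apply: sv; rewrite inE xs orbT.
Qed.

(** Volume packing: separated points of a ball of radius [M * r] are centres of disjoint balls
    inside one of radius [T * r]. Volumes are moved to balls about [1], the only ones for which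
    doubling is given. [D] is uniform in [r]. *)
Lemma doubling_covered r0 r1 (M : R) : 0 < M -> exists2 D : nat, (0 < D)%N &
  forall r Y m, 0 < r -> r <= r1 -> Y `<=` cball r0 ->
    covered (M * r) Y m -> covered r Y (D * m).
Proof.
move=> M0.
pose T := 2 * M + 1; have T0 : 0 < T by rewrite /T; lra.
(* [rho] bounds the points that occur and [rho'] also their inverses; the first Lipschitz constant
   serves only to find [rho']. *)
pose rho := `|r0| + `|T * r1| + `|r1|.
have [C1 C11 hC1] := lipschitz rho.
pose rho' := rho + C1 * rho.
have rho0 : 0 <= rho by rewrite /rho !addr_ge0.
have rr : rho <= rho' by rewrite /rho' lerDl mulr_ge0 //; lra.
have [C C11' hC] := lipschitz rho'.
(* Enough doublings to pass from radius [r / (2 * C)] to radius [C * (T * r)]. *)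
have [j hj] : exists j, 2 * C ^+ 2 * T <= 2 ^+ j.
  exists (Num.trunc (2 * C ^+ 2 * T)).+1.
  apply: le_trans (_ : (2 ^ (Num.trunc (2 * C ^+ 2 * T)).+1)%:R <= _); last by rewrite natrX.
  apply: (@le_trans _ _ (Num.trunc (2 * C ^+ 2 * T)).+1%:R); last first.
    by rewrite ler_nat ltnW // ltn_expl.
  by apply/ltW/truncnS_gt.
have [c c1 hc] := vol_doubling (2 ^+ j * `|r1|).
exists (Num.trunc (c ^+ j)).+1 => // r Y m rp rr1 hY [F Fm FY].
have r1n : r <= `|r1| by apply: le_trans rr1 (ler_norm _).
have Tr1 : T * r <= `|T * r1|.
  by apply: le_trans (ler_norm _); rewrite ler_pM2l.
have r00 : r0 <= `|r0| by exact: ler_norm.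
pose q := r / (2 * C).
have C0 : 0 < C by lra.
have q0 : 0 < q by rewrite /q divr_gt0 // mulr_gt0.
have qr : C * q = r / 2 by rewrite /q; field; lra.
have qr' : q <= r by nra.
have r0rho : r0 <= rho.
  by rewrite /rho; have := normr_ge0 (T * r1); have := normr_ge0 r1; lra.
have in_rho : Y `<=` cball rho by apply: subset_trans hY _; exact: cball_le.
have one_rho : cball rho' 1%g by rewrite /cball /= mdistxx; lra.
have key c0 s : separated r s ->
    {in s, forall x, (Y `&` ball c0 (M * r)) x} ->
    (size s <= (Num.trunc (c ^+ j)).+1)%N.
  case: s => [//|z s]; set l := z :: s => sl lY.
  have [Yz cz] := lY z (mem_head _ _); have rz := in_rho z Yz.
  have rzV : cball rho' z^-1%g.
    have [_ _] := hC1 1%g z 1%g ltac:(rewrite /cball /= mdistxx; lra) rz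
      ltac:(rewrite /cball /= mdistxx; lra).
    have : C1 * d 1%g z <= C1 * rho by rewrite ler_pM2l //; lra.
    by rewrite /cball /= invg1 /rho'; lra.
  have up : (mu (ball z (T * r)) <= (vol (2 ^+ j * q))%:E)%E.
    apply: (@ball_mull_sup _ _ _ C) => //; first exact: mulr_gt0.
      have -> : C * (T * r) = 2 * C ^+ 2 * T * q by rewrite -(@mulrA _ _ T) /q; field; lra.
      by rewrite ler_pM2r.
    move=> y zy; have [|||//] := hC z y z^-1%g.
    - by apply: cball_le rz.
    - rewrite /cball /= in rz *; have := metric_triangle 1%g z y.
      have := hY z Yz; rewrite /cball /= => h.
      rewrite /rho; have := normr_ge0 r1; have := rr; rewrite /rho; lra.
    - exact: rzV.
  have low : {in l, forall x, ((vol q)%:E <= mu (ball x (r / 2)))%E}.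
    move=> x /lY[Yx _]; apply: (@ball_mull_sub _ _ _ C) => //; first by rewrite qr.
    move=> w w1; have [|||//] := hC 1%g w x.
    - exact: one_rho.
    - rewrite /cball /=; have := rr; rewrite /rho.
      have := normr_ge0 r0; have := normr_ge0 (T * r1); lra.
    - exact: cball_le (in_rho x Yx).
  have := @disjoint_balls l (r / 2) (vol q) (ball z (T * r)).
  have -> : 2 * (r / 2) = r by field.
  move=> /(_ sl (open_ball _ _) _ low) big.
  have {big} : (size l)%:R * vol q <= vol (2 ^+ j * q).
    rewrite -lee_fin; apply: le_trans (big _) up.
    move=> x xl y; rewrite !ballEmdist /= => xy.
    have [_] := lY x xl; move: cz; rewrite !ballEmdist /= => cz cx.
    have := metric_triangle z x y; have := metric_triangle z c0 x.
    by rewrite (metric_sym z c0) /T; lra.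
  have /(hc j _ q0) h : 2 ^+ j * q <= 2 ^+ j * `|r1|.
    by rewrite ler_pM2l ?exprn_gt0 //; lra.
  move=> /le_trans/(_ h); rewrite ler_pM2r ?vol_gt0 // => h2.
  by rewrite -(ler_nat R); apply: le_trans h2 (ltW (truncnS_gt _)).
have : {in F, forall c0, covered r (Y `&` ball c0 (M * r)) (Num.trunc (c ^+ j)).+1}.
  move=> c0 _; have [s [ss sY cs]] := maximal_separated rp (key c0).
  exact: covered_leq (key c0 s ss sY) cs.
move=> /covered_seq cY; apply: covered_leq (covered_sub _ cY).
  by rewrite mulnC leq_mul2l Fm orbT.
move=> y Yy; have [c0 cF cy] := FY y Yy; exists c0 => //; split=> //.
by rewrite ballEmdist.
Qed.

End BallMeasure.

(** * Existence of scales, covering numbers and topology *)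

Section ExistsScale.
Variables (R : realType) (G : metricGroupType R).
Variables (mu : {measure set (borel G) -> \bar R}) (hG : locally_reasonable mu).

Local Notation d := (@mdist R G).

Lemma compact_cball (K : set G) : compact K -> exists r, K `<=` @cball R G r.
Proof.
rewrite compact_cover => /(_ nat setT (fun n => ball (1%g : G) n%:R)) [].
- by move=> n _; exact: open_ball.
- move=> x _; exists (Num.trunc (d 1%g x)).+1 => //.
  by rewrite ballEmdist /=; exact: truncnS_gt.
move=> E _ KE; exists (\max_(i <- E) i)%:R => x /KE[n nE].
rewrite ballEmdist /= => /ltW xn; apply: le_trans xn _.
by rewrite ler_nat; apply: leq_bigmax_seq.
Qed.

(** Balls about [1] need not be symmetric, whereas inversion has to preserve levels. *)
Definition symball (r : R) : set G :=
  [set x | d 1%g x <= r /\ d 1%g x^-1%g <= r].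

Fixpoint level (r : R) (k : nat) : set G :=
  if k is k'.+1 then mulsetg (symball r) (level r k') else [set 1%g].

Lemma level_mul r k l x y :
  level r k x -> level r l y -> level r (k + l) (x * y)%g.
Proof.
elim: k x => [|k IH] x /=; first by move=> ->; rewrite mul1g.
move=> [e He [x' Hx' <-]] Hy; exists e => //; exists (x' * y)%g; first exact: IH.
by rewrite mulgA.
Qed.

Lemma symball_level r x : symball r x -> level r 1 x.
Proof. by move=> h; exists x => //; exists 1%g => //; rewrite mulg1. Qed.

Lemma level_inv r k x : level r k x -> level r k x^-1%g.
Proof.
elim: k x => [|k IH] x /=; first by move=> ->; rewrite /= invg1.
move=> [e [e1 e2] [x' /IH Hx' <-]]; rewrite invgM.
have : level r (k + 1) (x'^-1 * e^-1)%g.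
  by apply: level_mul => //; apply: symball_level; split; rewrite ?invgK.
by rewrite addn1.
Qed.

Lemma level_le r k l : 0 <= r -> (k <= l)%N -> level r k `<=` level r l.
Proof.
move=> r0 /subnKC <- x hx; rewrite -(mulg1 x); apply: level_mul => //.
elim: (l - k)%N => [|n IH] //; exists 1%g; first by rewrite /symball /= invg1 mdistxx.
by exists 1%g => //; rewrite mulg1.
Qed.

Lemma level_cball r k : 0 <= r -> exists r', level r k `<=` @cball R G r'.
Proof.
move=> r0; elim: k => [|k [r' IH]].
  by exists 0 => _ ->; rewrite /cball /= mdistxx.
have [C C1 hC] := lipschitz hG (r + `|r'|).
exists (r + C * (r + `|r'|)) => _ [e [e1 _] [x /IH hx <-]]; rewrite /cball /= in hx *.
have r'r := ler_norm r'; have r'0 := normr_ge0 r'.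
have [|||h _ _] := hC 1%g x e; rewrite /cball /= ?mdistxx ?addr_ge0 //; try lra.
have := metric_triangle 1%g e (e * x)%g; rewrite mulg1 in h.
have : C * d 1%g x <= C * (r + `|r'|) by rewrite ler_pM2l; lra.
lra.
Qed.

(** All the data are chosen before [eps]; this uniformity is what makes the final constants
    independent of [eps]. *)
Lemma exists_scale (r0 R0 : R) : exists (lev : nat -> set G) (C c0 : R) (D : nat),
  [/\ 0 < c0, c0 <= 1, (0 < D)%N, @cball R G r0 `<=` lev 1%N &
    exists r, lev 30%N `<=` @cball R G r] /\
  forall eps, 0 < eps -> eps < R0 -> scale lev C (c0 * eps) D /\
    forall Y m, Y `<=` lev 30%N -> covered eps Y m ->
      covered (c0 * eps) Y (D * m).
Proof.
pose r1 := Num.max r0 1; have [C1 C11 hC1] := lipschitz hG r1.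
have r11 : 1 <= r1 by rewrite /r1 le_max lexx orbT.
have sub1 : @cball R G r1 `<=` level (C1 * r1) 1.
  move=> x hx; apply: symball_level; rewrite /cball /= in hx.
  have [|||_ _] := hC1 1%g x 1%g; rewrite /cball /= ?mdistxx //; try lra.
  rewrite invg1 => h.
  have : C1 * d 1%g x <= C1 * r1 by rewrite ler_pM2l //; lra.
  have : 1 * r1 <= C1 * r1 by rewrite ler_pM2r; lra.
  by split; lra.
have Cr0 : 0 <= C1 * r1 by rewrite mulr_ge0 //; lra.
have [r hr] := level_cball 30 Cr0.
have [C C_1 hC] := lipschitz hG r.
(* [C] depends on the levels, so enlarging the levels to contain a ball of radius [2 * C * R0] would
   be circular. Shrinking the scale instead ensures [2 * C * (c0 * eps) <= 1], and [lev 1] contains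
   the unit ball. *)
pose c0 := (1 + 2 * C * `|R0|)^-1.
have den : 1 <= 1 + 2 * C * `|R0| by rewrite lerDl !mulr_ge0 //; lra.
have c00 : 0 < c0 by rewrite invr_gt0; lra.
have c01 : c0 <= 1 by rewrite invf_le1 //; lra.
have [D1 D10 hD1] := doubling_covered hG r `|R0| (M := 16 * C ^+ 6)
  ltac:(rewrite mulr_gt0 // exprn_gt0 //; lra).
have [D2 D20 hD2] := doubling_covered hG r `|R0| (M := c0^-1)
  ltac:(rewrite invr_gt0 //).
exists (level (C1 * r1)), C, c0, (D1 + D2)%N; split.
  split=> //; first by rewrite addn_gt0 D10.
    apply: subset_trans (cball_le _) sub1.
    by rewrite /r1 le_max lexx.
  by exists r.
move=> eps e0 eR.
have d0 : 0 < c0 * eps by exact: mulr_gt0.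
have eRn : eps <= `|R0| by apply: le_trans (ltW eR) (ler_norm _).
have dR : c0 * eps <= `|R0|.
  by apply: le_trans eRn; rewrite ger_pMl.
split.
  split=> //.
  - exact: level_mul.
  - exact: level_inv.
  - by move=> k l; exact: level_le.
  - by move=> g x y /hr hg /hr hx /hr hy; exact: hC.
  - move=> u hu; apply: sub1; rewrite /cball /=; apply: le_trans (ltW hu) _.
    apply: le_trans r11.
    have -> : 2 * C * (c0 * eps) = (2 * C * eps) / (1 + 2 * C * `|R0|).
      by rewrite /c0; ring.
    rewrite ler_pdivrMr; last lra.
    have : 2 * C * eps <= 2 * C * `|R0| by rewrite ler_pM2l //; lra.
    lra.
  - move=> Y m hY cY; apply: covered_leq (hD1 _ _ _ d0 dR (subset_trans hY hr) cY).
    by rewrite leq_mul2r leq_addr orbT.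
move=> Y m hY cY; apply: (@covered_leq _ _ _ _ (D2 * m)).
  by rewrite leq_mul2r leq_addl orbT.
apply: hD2 => //; first exact: subset_trans hY hr.
by rewrite mulrA mulVf ?mul1r //; lra.
Qed.

(** Only finiteness matters here: the bound may depend on [eps], and it makes covering numbers
    natural numbers. *)
Lemma bounded_covered r eps : 0 < eps ->
  exists m, forall Y, Y `<=` @cball R G r -> covered eps Y m.
Proof.
move=> e0; have [D D0 hD] := doubling_covered hG r eps (M := (`|r| + 1) / eps)
  ltac:(rewrite divr_gt0 // ltr_wpDl //).
exists (D * 1)%N => Y hY; apply: hD => //.
exists [:: 1%g] => // y /hY; rewrite /cball /= => yr.
exists 1%g; first by rewrite mem_head.
rewrite divfK; last lra.
by have := ler_norm r; lra.
Qed.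

Lemma covering_number_le eps (X : set G) m : covered eps X m ->
  (covering_number eps X <= m%:R%:E)%E.
Proof.
move=> [F Fm FX]; apply: ge_ereal_inf; exists (#|` [fset x in F]%fset|%:R)%:E.
  exists [fset x in F]%fset => // x /FX[c cF cx].
  by exists c; rewrite /= ?inE // ballEmdist.
by rewrite lee_fin ler_nat card_fseq; apply: leq_trans Fm; exact: size_undup.
Qed.

Lemma covering_number_attained eps (X : set G) m : covered eps X m ->
  exists a, [/\ covering_number eps X = a%:R%:E, covered eps X a &
    forall b, covered eps X b -> (a <= b)%N].
Proof.
move=> cX; pose P m := `[< covered eps X m >].
have exP : exists m, P m by exists m; apply/asboolP.
have [a /asboolP ca mina] := ex_minnP exP; exists a; split=> //; last first.
  by move=> b cb; apply: mina; apply/asboolP.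
apply/eqP; rewrite eq_le covering_number_le //=; apply: le_ereal_inf_tmp.
move=> _ [F FX <-]; rewrite lee_fin ler_nat; apply: mina; apply/asboolP.
exists (enum_fset F) => // x /FX[c cF]; rewrite ballEmdist => cx.
by exists c.
Qed.

Lemma covered_gt0 eps (X : set G) a : X !=set0 -> covered eps X a -> (0 < a)%N.
Proof.
move=> [x Xx] [[|c F] Fa FX]; first by have [] := FX x Xx.
exact: leq_trans Fa.
Qed.

Lemma open_group (C delta : R) (S : set G) :
  open (mulsetg S (mulsetg (@unit_nbhs R G C delta) S)).
Proof.
set U := unit_nbhs C delta.
have oU : open U.
  have -> : U = ball (1%g : G) (2 * rad C delta 1) `&`
      (fun x => x^-1%g) @^-1` ball (1%g : G) (2 * rad C delta 1).
    by rewrite ballEmdist.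
  apply: openI; first exact: open_ball.
  have /continuousP ic := invg_continuous (lr_multiplicative hG).
  by apply: ic; exact: open_ball.
have -> : mulsetg S (mulsetg U S) =
    \bigcup_(st in S `*` S) [set y | U (st.1^-1 * y * st.2^-1)%g].
  apply/seteqP; split=> [_ [s Ss [_ [u Uu [t St <-]] <-]]|y [[s t] [Ss St] /= Uy]].
    by exists (s, t) => //=; rewrite mulKg mulgK.
  exists s => //; exists (s^-1 * y)%g; last by rewrite mulVKg.
  by exists (s^-1 * y * t^-1)%g => //; exists t => //; rewrite mulgVK.
by apply: bigcup_open => st _; exact: (open_translate hG).
Qed.

Lemma cball_precompact r (X : set G) : X `<=` @cball R G r -> precompact X.
Proof.
move=> Xr; exists (@cball R G r) => //; split.
  exact: (@lr_closed_ball _ _ _ hG 1%g r).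
apply: compact_closed; first exact: metric_hausdorff.
exact: (@lr_closed_ball _ _ _ hG 1%g r).
Qed.

End ExistsScale.

(** * From a small product to small quotients *)

(** The triangle inequality is applied through [B^-1], to [A B] and its inverse [B^-1 A^-1]; the
    factor [b] in [v ^ 2] cancels against a separated subset of [B^-1]. The comparison of [a] with
    [b] serves later to replace [a] by a product of square roots. *)
Lemma small_product_quotients (R : realType) (G : metricGroupType R)
    (lev : nat -> set G) (C delta : R) (D : nat) (hS : scale lev C delta D)
    (eps : R) (A B : set G) (a b v L : nat) :
  delta <= eps ->
  (forall Y m, Y `<=` lev 30%N -> covered eps Y m -> covered delta Y (D * m)) ->
  (0 < D)%N -> A `<=` lev 1%N -> B `<=` lev 1%N -> A !=set0 -> B !=set0 ->
  covered eps A a -> (forall m, covered eps A m -> (a <= m)%N) ->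
  covered eps B b -> (forall m, covered eps B m -> (b <= m)%N) ->
  covered eps (mulsetg A B) v -> (v ^ 2 <= L ^ 2 * (a * b))%N ->
  let k := (D ^ 7 * L ^ 2)%N in
  (a <= D ^ 4 * L ^ 2 * b)%N /\
  exists A0 : seq G,
    [/\ separated (8 * rad C delta 4) A0, {in A0, forall x, A x},
        (0 < size A0)%N /\ (size A0 <= D * a)%N, covered delta A (D * size A0) &
        covered delta (mulsetg A (invsetg A)) (k * size A0) /\
        covered delta (mulsetg A B) (k * size A0)].
Proof.
move=> de conv D0 levA levB [a0 Aa0] [b0 Bb0] cA minA cB minB cAB vab k.
have up i j Y : Y `<=` lev i -> (i <= j)%N -> Y `<=` lev j.
  by move=> hY ij; apply: subset_trans hY (lev_le hS ij).
have lev14 Y : Y `<=` lev 1%N -> Y `<=` lev 14%N by move=> /up; exact.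
have lev30 Y : Y `<=` lev 1%N -> Y `<=` lev 30%N by move=> /up; exact.
have lev2 Y : Y `<=` lev 1%N -> Y `<=` lev 2%N by move=> /up; exact.
have levAB := mulsetg_lev hS levA levB.
have dAB : covered delta (mulsetg A B) (D * v) by apply: conv (up _ _ _ levAB _) cAB.
have dA : covered delta A (D * a) by apply: conv (lev30 _ levA) cA.
have dB : covered delta B (D * b) by apply: conv (lev30 _ levB) cB.
have a_gt0 : (0 < a)%N by apply: covered_gt0 cA; exists a0.
have b_gt0 : (0 < b)%N by apply: covered_gt0 cB; exists b0.
(* A right translate of [A] lies in [A B]. *)
have av : (a <= D ^ 2 * v)%N.
  rewrite -mulnn -mulnA; apply/minA/(covered_le de).
  exact: (covered_mulr hS levB Bb0 (lev14 _ levA) dAB).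
have bv : (b <= D ^ 2 * v)%N.
  rewrite -mulnn -mulnA; apply/minB/(covered_le de).
  exact: (covered_mull hS levA Aa0 (lev14 _ levB) dAB).
have ab : (a <= D ^ 4 * L ^ 2 * b)%N.
  rewrite -(leq_pmul2l a_gt0) mulnn; apply: (@leq_trans ((D ^ 2 * v) ^ 2)).
    by rewrite leq_sqr.
  apply: (@leq_trans (D ^ 4 * (L ^ 2 * (a * b)))); last by apply/eq_leq; ring.
  by rewrite expnMn -expnM leq_mul2l vab orbT.
have ba : (b <= D ^ 4 * L ^ 2 * a)%N.
  rewrite -(leq_pmul2l b_gt0) mulnn; apply: (@leq_trans ((D ^ 2 * v) ^ 2)).
    by rewrite leq_sqr.
  apply: (@leq_trans (D ^ 4 * (L ^ 2 * (a * b)))); last by apply/eq_leq; ring.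
  by rewrite expnMn -expnM leq_mul2l vab orbT.
have [w0 r01] : 0 < rad C delta 0 /\ rad C delta 0 <= rad C delta 4.
  by split; [exact: (rad_gt0 hS)|exact: (rad_le hS)].
have r46 : rad C delta 4 <= rad C delta 6 by exact: (rad_le hS).
have w00 := rad0 C delta.
have sepd (Z : seq G) : separated (8 * rad C delta 4) Z -> separated (2 * delta) Z.
  move=> [uZ sZ]; split=> // x y xZ yZ xy; apply: sZ => //.
  by apply: lt_le_trans xy _; lra.
have [A0 [sA0 A0A cA0]] : exists A0, [/\ separated (8 * rad C delta 4) A0,
    {in A0, forall x, A x} & covered (8 * rad C delta 4) A (size A0)].
  apply: (@maximal_separated _ _ _ _ (D * a)); first lra.
  by move=> s ss sA; exact: (size_separated dA (sepd _ ss) sA).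
have dA0 : covered delta A (D * size A0).
  by apply: (covered_rad hS (lev30 _ levA) _ cA0); lra.
have nDa : (size A0 <= D * a)%N by exact: (size_separated dA (sepd _ sA0) A0A).
have aDn : (a <= D * size A0)%N by apply/minA/(covered_le de).
have n_gt0 : (0 < size A0)%N by apply: covered_gt0 cA0; exists a0.
have levBV := invsetg_lev hS levB; have levAV := invsetg_lev hS levA.
have dBV := covered_inv hS (lev14 _ levB) dB.
have [Z0 [sZ0 Z0B cZ0]] : exists Z0, [/\ separated (8 * rad C delta 4) Z0,
    {in Z0, forall x, invsetg B x} & covered (8 * rad C delta 4) (invsetg B) (size Z0)].
  apply: (@maximal_separated _ _ _ _ (D * (D * b))); first lra.
  by move=> s ss sA; exact: (size_separated dBV (sepd _ ss) sA).
have z_gt0 : (0 < size Z0)%N by apply: covered_gt0 cZ0; exists b0^-1%g; exists b0.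
have bz : (b <= D ^ 2 * size Z0)%N.
  rewrite -mulnn -mulnA; apply/minB/(covered_le de).
  have h : covered delta (invsetg B) (D * size Z0).
    by apply: (covered_rad hS (lev30 _ levBV) _ cZ0); lra.
  apply: covered_sub (covered_inv hS (lev14 _ levBV) h) => x Bx.
  by exists x^-1%g; [exists x | rewrite invgK].
have dAB' : covered delta (mulsetg A (invsetg (invsetg B))) (D * v).
  apply: covered_sub dAB => _ [x Ax [_ [_ [y By <-] <-] <-]].
  by rewrite invgK; exists x => //; exists y.
have dBA : covered delta (mulsetg (invsetg B) (invsetg A)) (D * (D * v)).
  apply: covered_sub (covered_inv hS (up _ _ _ levAB _) dAB) => //.
  move=> _ [_ [y By <-] [_ [x Ax <-] <-]]; exists (x * y)%g; last by rewrite invgM.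
  by exists x => //; exists y.
have [m mz cm] := covered_triangle hS (lev2 _ levA) (lev2 _ levBV) (lev2 _ levAV)
  sZ0 Z0B z_gt0 dAB' dBA.
split=> //; exists A0; split=> //; split.
  apply: covered_leq cm.
  have : (m <= D ^ 5 * L ^ 2 * a)%N.
    rewrite -(leq_pmul2r z_gt0); apply: leq_trans mz _.
    apply: (@leq_trans (D ^ 3 * v ^ 2)).
      by apply/eq_leq; ring.
    apply: (@leq_trans (D ^ 3 * (L ^ 2 * (a * (D ^ 2 * size Z0))))).
      rewrite leq_mul2l; apply/orP; right; apply: leq_trans vab _.
      by rewrite !leq_mul.
    by apply/eq_leq; ring.
  move=> h; apply: (@leq_trans (D * (D ^ 5 * L ^ 2 * (D * size A0)))).
    by rewrite leq_mul2l (leq_trans h) ?orbT // leq_mul.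
  by apply/eq_leq; rewrite /k; ring.
apply: covered_leq dAB.
have : (v <= D ^ 2 * L ^ 2 * a)%N.
  rewrite -leq_sqr; apply: leq_trans vab _.
  apply: (@leq_trans (L ^ 2 * (a * (D ^ 4 * L ^ 2 * a)))).
    by rewrite !leq_mul.
  by apply/eq_leq; ring.
move=> h; apply: (@leq_trans (D * (D ^ 2 * L ^ 2 * (D * size A0)))).
  by rewrite leq_mul2l (leq_trans h) ?orbT // leq_mul.
rewrite [leqLHS](_ : _ = D ^ 4 * L ^ 2 * size A0)%N; last by ring.
by rewrite /k !leq_mul2r (leq_pexp2l D0) ?orbT.
Qed.

(** * Polynomial bounds and the two implications *)

Lemma poly_bound_ge (R : realType) (C C' K : R) : 1 <= K -> 0 < C -> C <= C' ->
  poly_bound C K <= poly_bound C' K.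
Proof.
move=> K1 C0 CC; apply: ler_pM => //; rewrite ?powR_ge0 //; first exact: ltW.
exact: ler_powR.
Qed.

Lemma poly_bound_ge0 (R : realType) (C K : R) : 0 < C -> 0 <= poly_bound C K.
Proof. by move=> C0; rewrite mulr_ge0 ?powR_ge0 // ltW. Qed.

(** One constant acts as both factor and exponent, so it has to dominate [C * C'] and [C + C'] at
    once. *)
Lemma poly_bound_mul (R : realType) (C C' K : R) : 1 <= K -> 0 < C -> 0 < C' ->
  poly_bound C K * poly_bound C' K <= poly_bound (C * C' + C + C') K.
Proof.
move=> K1 C0 C0'; have K0 : 0 < K by lra.
have CC : 0 < C * C' by exact: mulr_gt0.
rewrite /poly_bound mulrACA -powRD; last by rewrite (gt_eqF K0) implybT.
apply: ler_pM; rewrite ?powR_ge0 //; [lra|lra|].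
by apply: ler_powR => //; lra.
Qed.

Lemma poly_bound_exp (R : realType) (C c : R) (j : nat) : 0 < C -> 0 < c ->
  exists2 C', 0 < C' & forall K, 1 <= K ->
    c * (poly_bound C K + 1) ^+ j <= poly_bound C' K.
Proof.
move=> C0 c0; elim: j => [|j [C' C'0 IH]].
  exists c => // K K1; rewrite expr0 mulr1 /poly_bound ler_peMr //; first exact: ltW.
  by rewrite -(powRr0 K) ler_powR // ltW.
exists (C' * (C + 1) + C' + (C + 1)) => [|K K1].
  by rewrite !addr_gt0 // mulr_gt0 // addr_gt0.
apply: le_trans (poly_bound_mul K1 C'0 _); last by rewrite addr_gt0.
rewrite exprSr mulrA; apply: ler_pM (IH K K1) _; rewrite ?mulr_ge0 ?exprn_ge0 //.
- exact: ltW.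
- by rewrite addr_ge0 ?poly_bound_ge0.
- by rewrite addr_ge0 ?poly_bound_ge0.
have K_ge1 : 1 <= K `^ (C + 1).
  by rewrite -{1}(powRr0 K); apply: ler_powR => //; lra.
have : C * K `^ C <= C * K `^ (C + 1).
  by rewrite ler_pM2l //; apply: ler_powR => //; lra.
by rewrite /poly_bound; lra.
Qed.

Lemma entropy_boundE (R : realType) (G : metricGroupType R) (C eps K : R)
    (A B : set G) (a b : nat) :
  covering_number eps A = a%:R%:E -> covering_number eps B = b%:R%:E ->
  entropy_bound C eps K A B =
    (poly_bound C K * (Num.sqrt a%:R * Num.sqrt b%:R))%:E.
Proof.
by move=> ha hb; rewrite /entropy_bound ha hb !poweR_EFin !powR12_sqrt // -!EFinM.
Qed.

(** With [k = D ^ 7 * L ^ 2], the constant of the core lemma is [2 ^ 6 * D ^ 86 * L ^ 22]. Joining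
    two lists in each finite set costs a factor [2], and expressing [size A0] by the square roots
    costs [D ^ 3 * L]. The [+ 1] under the power pays for rounding up to the integer [L]. *)
Lemma small_product_controlled (R : realType) (G : metricGroupType R)
    (mu : {measure set (borel G) -> \bar R}) (hG : locally_reasonable mu)
    (lev : nat -> set G) (M delta : R) (D : nat) (hS : scale lev M delta D)
    (r' : R) (levr' : lev 30%N `<=` @cball R G r')
    (C C' eps K : R) (A B : set G) :
  0 < C -> 1 <= K -> 0 < eps -> delta <= eps -> (0 < D)%N ->
  (forall Y m, Y `<=` lev 30%N -> covered eps Y m -> covered delta Y (D * m)) ->
  (2 ^ 7 * D ^ 89)%:R * (poly_bound C K + 1) ^+ 23 <= poly_bound C' K ->
  A `<=` lev 1%N -> B `<=` lev 1%N -> A !=set0 -> B !=set0 ->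
  small_product C eps K A B ->
  controlled_by_approximate_group (@cball R G r') C' C' C' eps K A B.
Proof.
move=> C0 K1 e0 de D0 conv hC' levA levB A0 B0 hAB.
have up i Y : Y `<=` lev i -> (i <= 30)%N -> Y `<=` lev 30%N.
  by move=> hY ij; apply: subset_trans hY (lev_le hS ij).
have [m0 hm0] := bounded_covered hG r' e0.
have fin i Y : Y `<=` lev i -> (i <= 30)%N -> covered eps Y m0.
  by move=> hY i30; apply/hm0/(subset_trans _ levr')/(up i).
have [a [aE cA mina]] := covering_number_attained (fin 1%N A levA isT).
have [b [bE cB minb]] := covering_number_attained (fin 1%N B levB isT).
have [v [vE cAB _]] := covering_number_attained (fin 2%N _ (mulsetg_lev hS levA levB) isT).
set P := poly_bound C K in hC'.
have P0 : 0 <= P by exact: poly_bound_ge0.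
pose L := (Num.trunc P).+1.
have PL : P <= L%:R by exact/ltW/truncnS_gt.
have LP : L%:R <= P + 1 by rewrite -natr1 lerD2r truncn_le.
have vab : (v ^ 2 <= L ^ 2 * (a * b))%N.
  have : v%:R <= L%:R * (Num.sqrt a%:R * Num.sqrt b%:R) :> R.
    move: hAB; rewrite /small_product vE (entropy_boundE _ _ aE bE) lee_fin.
    by move=> /le_trans; apply; rewrite ler_wpM2r // mulr_ge0 ?sqrtr_ge0.
  rewrite -(@ler_pXn2r _ 2) ?nnegrE ?mulr_ge0 ?sqrtr_ge0 //.
  by rewrite !exprMn !sqr_sqrtr // -!natrX -!natrM ler_nat.
have [aDb [X0 [sX0 X0A [n0 nDa] dA [dAA dAB]]]] := small_product_quotients hS
  de conv D0 levA levB A0 B0 cA mina cB minb cAB vab.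
set k := (D ^ 7 * L ^ 2)%N in dAA dAB.
have k0 : (0 < k)%N by rewrite muln_gt0 !expn_gt0 D0.
have [S [[S0 HV levH cH] [X1 [X2 [X3 [X1H [s1 [s2 s3]] [X2A X3B] [c1 c2 c3]]]]]]] :=
  approximate_group_core hS k0 D0 levA levB sX0 X0A n0 dA dAA dAB.
set H := mulsetg S _ in HV levH cH X1H c1 c2 c3.
set E := (2 ^ 6 * k ^ 11 * D ^ 9)%N in cH s1 s2 s3.
have EE : (E = 2 ^ 6 * D ^ 86 * L ^ 22)%N by rewrite /E /k; ring.
have bnd : (2 ^ 7 * D ^ 89 * L ^ 23)%:R <= poly_bound C' K.
  apply: le_trans hC'; rewrite natrM (natrX _ L 23) ler_wpM2l //.
  by apply: lerXn2r LP; rewrite nnegrE // addr_ge0.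
have twoE : (E + E)%:R <= poly_bound C' K.
  apply: le_trans bnd; rewrite ler_nat EE.
  rewrite [leqLHS](_ : _ = 2 ^ 7 * D ^ 86 * L ^ 22)%N; last by ring.
  by apply: leq_mul; [rewrite leq_mul2l (leq_pexp2l D0) ?orbT | rewrite leq_pexp2l].
have levHr : H `<=` @cball R G r' by apply: subset_trans (up _ _ levH _) levr'.
have card_seq (s : seq G) : (size s <= E + E)%N ->
    (#|` [fset x in s]%fset|)%:R <= poly_bound C' K.
  move=> sE; apply: le_trans twoE; rewrite ler_nat card_fseq.
  exact: leq_trans (size_undup _) sE.
have inF (s : seq G) x : [set` [fset y in s]%fset] x = (x \in s).
  by rewrite /= inE.
exists H, [fset x in X2 ++ X3]%fset; split.
- split=> //.
    split; [|exact: (open_group hG)|exact: (cball_precompact hG levHr)].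
    case: S0 => s Ss; exists (s * (1 * s))%g; exists s => //.
    exists (1 * s)%g => //; exists 1%g; last by exists s.
    rewrite /unit_nbhs /= invg1 mdistxx; split; apply: mulr_gt0 => //; exact: (rad_gt0 hS).
  (* [X1] lies in [H H], which is symmetric, so adding the inverses stays inside it. *)
  exists [fset x in X1 ++ [seq x^-1%g | x <- X1]]%fset.
  have XV x : x \in X1 ++ [seq x^-1%g | x <- X1] ->
      x^-1%g \in X1 ++ [seq x^-1%g | x <- X1].
    rewrite !mem_cat => /orP[xX|/mapP[y yX ->]]; last by rewrite invgK yX.
    by apply/orP; right; apply/mapP; exists x.
  split.
  + apply/seteqP; split=> [_ [x + <-]|x].
      by rewrite !inF; exact: XV.
    by rewrite inF => xX; exists x^-1%g; rewrite ?invgK // inF; exact: XV.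
  + move=> x; rewrite inF mem_cat => /orP[/X1H//|/mapP[y /X1H[g Hg [h Hh <-]] ->]].
    rewrite invgM; exists h^-1%g; first by rewrite -HV; exists h.
    by exists g^-1%g => //; rewrite -HV; exists g.
  + by apply: card_seq; rewrite size_cat size_map leq_add.
  + apply: subset_trans c1 _ => _ [x xX1 [h Hh <-]]; exists x; last by exists h.
    by rewrite inF mem_cat; apply/orP; left.
- rewrite (entropy_boundE _ _ aE bE).
  apply: le_trans (covering_number_le (covered_le de cH)) _; rewrite lee_fin.
  apply: (@le_trans _ _ (E * D * a)%:R).
    by rewrite ler_nat -mulnA leq_mul2l nDa orbT.
  have sa : Num.sqrt a%:R <= (D ^ 2 * L)%:R * Num.sqrt b%:R :> R.
    rewrite -(@ler_pXn2r _ 2) ?nnegrE ?mulr_ge0 ?sqrtr_ge0 //.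
    rewrite exprMn !sqr_sqrtr // -natrX -natrM ler_nat.
    by rewrite expnMn -expnM.
  apply: (@le_trans _ _ ((E * D * (D ^ 2 * L))%:R * (Num.sqrt a%:R * Num.sqrt b%:R))).
    rewrite natrM [leRHS](_ : _ = (E * D)%:R *
      (Num.sqrt a%:R * ((D ^ 2 * L)%:R * Num.sqrt b%:R))); last first.
      by rewrite (natrM _ (E * D)); ring.
    rewrite ler_wpM2l // -{1}(sqr_sqrtr (ler0n R a)) expr2.
    by rewrite ler_wpM2l ?sqrtr_ge0.
  rewrite ler_wpM2r ?mulr_ge0 ?sqrtr_ge0 //; apply: le_trans bnd.
  rewrite ler_nat EE [leqLHS](_ : _ = 2 ^ 6 * D ^ 89 * L ^ 23)%N; last by ring.
  by rewrite !leq_mul2r leq_pexp2l ?orbT.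
- by apply: card_seq; rewrite size_cat leq_add.
- split.
    apply: subset_trans c2 _ => _ [x xX [h Hh <-]]; exists x; last by exists h.
    by rewrite inF mem_cat; apply/orP; left.
  apply: subset_trans c3 _ => _ [h Hh [x xX <-]]; exists h => //; exists x => //.
  by rewrite inF mem_cat; apply/orP; right.
split=> // x; rewrite inF mem_cat => xX; apply: levr'.
by case/orP: xX => [/X2A|/X3B]; [exact: (up 1%N A)|exact: (up 1%N B)].
Qed.

(** [A B] lies in [X H H X], hence in [X X' H X], a union of two-sided translates of [H]. The fourth
    power collects [X] twice, [X'] once and the entropy of [H]; one factor [D] is for going from
    [eps] to [delta], the other for resetting the radius after translation. *)
Lemma controlled_small_product (R : realType) (G : metricGroupType R)
    (mu : {measure set (borel G) -> \bar R}) (hG : locally_reasonable mu)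
    (lev : nat -> set G) (M delta : R) (D : nat) (hS : scale lev M delta D)
    (r' : R) (levr' : lev 30%N `<=` @cball R G r') (Kt : set G)
    (C1 C2 C3 C' eps K : R) (A B : set G) :
  0 < C1 -> 0 < C2 -> 0 < C3 -> 1 <= K -> 0 < eps -> delta <= eps ->
  (forall Y m, Y `<=` lev 30%N -> covered eps Y m -> covered delta Y (D * m)) ->
  (D ^ 2)%:R * (poly_bound (C1 + C2 + C3) K + 1) ^+ 4 <= poly_bound C' K ->
  A `<=` lev 1%N -> B `<=` lev 1%N -> Kt `<=` lev 1%N ->
  controlled_by_approximate_group Kt C1 C2 C3 eps K A B ->
  small_product C' eps K A B.
Proof.
move=> C10 C20 C30 K1 e0 de conv hC' levA levB levKt.
move=> [H [X [[_ _ [X' [_ X'H sX' cX']]] hH sX [AX BX] [HKt XKt]]]].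
have up i Y : Y `<=` lev i -> (i <= 30)%N -> Y `<=` lev 30%N.
  by move=> hY ij; apply: subset_trans hY (lev_le hS ij).
have [m0 hm0] := bounded_covered hG r' e0.
have fin i Y : Y `<=` lev i -> (i <= 30)%N -> covered eps Y m0.
  by move=> hY i30; apply/hm0/(subset_trans _ levr')/(up i).
have levH := subset_trans HKt levKt; have levX := subset_trans XKt levKt.
have [a [aE _ _]] := covering_number_attained (fin 1%N A levA isT).
have [b [bE _ _]] := covering_number_attained (fin 1%N B levB isT).
have [h [hE cH _]] := covering_number_attained (fin 1%N H levH isT).
have dH := conv H h (up _ _ levH isT) cH.
pose T := [seq (x, p) | x <- enum_fset X,
  p <- [seq (y, z) | y <- enum_fset X', z <- enum_fset X]].
pose Y (t : G * (G * G)) : set G :=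
  [set g | exists2 u, H u & g = (t.1 * t.2.1 * u * t.2.2)%g].
have TP t : t \in T -> [/\ lev 1%N t.1, lev 2%N t.2.1 & lev 1%N t.2.2].
  move=> /allpairsP[[x p] /= [xX /allpairsP[[y z] /= [yX' zX ->]] ->]] /=.
  split; [exact: levX| |exact: levX].
  by have [u /levH lu [w /levH lw <-]] := X'H y yX'; exact: (lev_mul hS lu lw).
have [w0 w1] := (rad0 M delta, rad_gt0 hS 6).
have r01 : rad M delta 0 <= rad M delta 1 by exact: (rad_le hS).
have r12 : rad M delta 1 <= rad M delta 2 by exact: (rad_le hS).
have r26 : rad M delta 2 <= rad M delta 6 by exact: (rad_le hS).
have cY : {in T, forall t, covered (2 * rad M delta 2) (Y t) (D * h)}.
  move=> t /TP[l1 l2 l3].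
  apply: (covered_rel
    (rel := fun g u => g = (t.1 * t.2.1 * u * t.2.2)%g) dH).
    by move=> g [u Hu ->]; exists u.
  move=> g g' u u' _ _ /levH lu /levH lu' -> -> uu.
  have k1 : mdist (t.1 * t.2.1 * u)%g (t.1 * t.2.1 * u')%g < 2 * rad M delta 1.
    by apply: (lipl hS _ _ _ uu); [lv|lv|lv|lra].
  by apply: (lipr hS _ _ _ k1); [lv|lv|lv|lra].
have cAB : covered (2 * rad M delta 2) (mulsetg A B) (size T * (D * h)).
  apply: covered_sub (covered_seq cY).
  move=> _ [x /AX[x1 xX1 [h1 Hh1 <-]] [y /BX[h2 Hh2 [x2 xX2 <-]] <-]].
  have [x' xX' [u Hu e]] : mulsetg [set` X'] H (h1 * h2)%g.
    by apply: cX'; exists h1 => //; exists h2.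
  exists (x1, (x', x2)).
    by apply: allpairs_f => //; apply: allpairs_f.
  by exists u => //=; rewrite -(mulgA x1 x') e !mulgA.
have {cAB} cAB : covered delta (mulsetg A B) (D * (size T * (D * h))).
  apply: (covered_rad hS _ _ cAB); last lra.
  exact: up (mulsetg_lev hS levA levB) _.
rewrite /small_product (entropy_boundE _ _ aE bE).
apply: le_trans (covering_number_le (covered_le de cAB)) _; rewrite lee_fin.
set s := Num.sqrt a%:R * _.
have s0 : 0 <= s by rewrite mulr_ge0 ?sqrtr_ge0.
pose P := poly_bound (C1 + C2 + C3) K + 1.
have P0 : 0 <= P by rewrite addr_ge0 // poly_bound_ge0 // !addr_gt0.
have leP x c : 0 < c -> c <= C1 + C2 + C3 -> x <= poly_bound c K -> x <= P.
  move=> c0 cc xc; apply: le_trans xc _; apply: le_trans (poly_bound_ge K1 c0 cc) _.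
  by rewrite lerDl.
have hs : h%:R <= P * s.
  move: hH; rewrite hE (entropy_boundE _ _ aE bE) lee_fin => /le_trans; apply.
  by rewrite ler_wpM2r // (leP _ C2) //; lra.
have xP : #|` X|%:R <= P by apply: (leP _ C3) => //; lra.
have xP' : #|` X'|%:R <= P by apply: (leP _ C1) => //; lra.
apply: (@le_trans _ _ ((D ^ 2)%:R * P ^+ 4 * s)); last first.
  by rewrite ler_wpM2r.
rewrite /T !size_allpairs !natrM.
rewrite [leLHS](_ : _ = (D ^ 2)%:R * (#|` X|%:R * (#|` X'|%:R * (#|` X|%:R * h%:R)))).
  rewrite [leRHS](_ : _ = (D ^ 2)%:R * (P * (P * (P * (P * s))))); last by ring.
  by apply: ler_wpM2l => //; rewrite !ler_pM ?mulr_ge0.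
by rewrite natrX; ring.
Qed.

Theorem theorem6p9 (R : realType) (G : metricGroupType R)
    (mu : {measure set (borel G) -> \bar R}) (hG : locally_reasonable mu)
    (cK : set G) (hcK : compact cK) (R0 : R) :
  (exists2 Kt : set G, compact Kt &
    forall C : R, 0 < C ->
    exists C1 C2 C3 : R, [/\ 0 < C1, 0 < C2, 0 < C3 &
      forall (eps K : R) (A B : set G),
        0 < eps -> eps < R0 -> 1 <= K ->
        A `<=` cK -> B `<=` cK -> A !=set0 -> B !=set0 ->
        small_product C eps K A B ->
        controlled_by_approximate_group Kt C1 C2 C3 eps K A B]) /\
  (forall Kt : set G, compact Kt ->
    forall C1 C2 C3 : R, 0 < C1 -> 0 < C2 -> 0 < C3 ->
    exists2 C : R, 0 < C &
      forall (eps K : R) (A B : set G),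
        0 < eps -> eps < R0 -> 1 <= K ->
        A `<=` cK -> B `<=` cK -> A !=set0 -> B !=set0 ->
        controlled_by_approximate_group Kt C1 C2 C3 eps K A B ->
        small_product C eps K A B).
Proof.
have [r hr] := compact_cball hcK; split.
  have [lev [M [c0 [D [[c00 c01 D0 levr [r' hr']] hS]]]]] := exists_scale hG r R0.
  (* This ball contains all levels used and is fixed before [C], [eps], [A] and [B]. *)
  exists (@cball R G r'); first exact: (@lr_closed_ball _ _ _ hG 1%g r').
  move=> C C0.
  have [|C' C'0 hC'] := @poly_bound_exp R C (2 ^ 7 * D ^ 89)%:R 23 C0.
    by rewrite ltr0n muln_gt0 !expn_gt0 D0.
  exists C', C', C'; split=> // eps K A B e0 eR K1 AK BK A0 B0.
  have [hSe conv] := hS eps e0 eR.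
  apply: (small_product_controlled hG hSe hr' C0 K1 e0 _ D0 conv (hC' K K1)) => //.
  - by rewrite ger_pMl.
  - exact: subset_trans AK (subset_trans hr levr).
  - exact: subset_trans BK (subset_trans hr levr).
move=> Kt /compact_cball[r2 hr2] C1 C2 C3 C10 C20 C30.
(* Here the first level must contain [Kt] as well as [cK]. *)
have [lev [M [c0 [D [[c00 c01 D0 levr [r' hr']] hS]]]]] :=
  exists_scale hG (Num.max r r2) R0.
have [||C' C'0 hC'] := @poly_bound_exp R (C1 + C2 + C3) (D ^ 2)%:R 4.
- by rewrite !addr_gt0.
- by rewrite ltr0n expn_gt0 D0.
exists C' => // eps K A B e0 eR K1 AK BK _ _.
have [hSe conv] := hS eps e0 eR.
have rlev : @cball R G r `<=` lev 1%N.
  by apply: subset_trans levr; apply: cball_le; rewrite le_max lexx.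
apply: (controlled_small_product hG hSe hr' C10 C20 C30 K1 e0 _ conv (hC' K K1)).
- by rewrite ger_pMl.
- exact: subset_trans AK (subset_trans hr rlev).
- exact: subset_trans BK (subset_trans hr rlev).
- apply: subset_trans hr2 (subset_trans _ levr).
  by apply: cball_le; rewrite le_max lexx orbT.
Qed.
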